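(* Let $\mathcal{L}$ be a countable language, let $\mathcal{F}$ be a topological Fraïssé $\mathcal{L}$-class, and let $\Xi$ be an admissible coding for models of $\mathcal{F}$. Then: (i) An existentially closed, projectively atomic model of $\mathcal{F}$ exists if and only if the projectively isolated types are dense in $\mathrm{S}_x(\mathcal{F})$ for every finite set of variables $x$. (ii) If it exists, the existentially closed, projectively atomic model of $\mathcal{F}$ is unique up to isomorphism and it is homogeneous. (iii) Let $M_0$ be a model of $\mathcal{F}$. The following are equivalent: (a) $M_0$ is existentially closed and projectively atomic; (b) $\{\xi\in\Xi: M_\xi\cong M_0\}$ is dense $G_\delta$ in $\Xi$; (c) $\{\xi\in\Xi: M_\xi\cong M_0\}$ is non-meager in $\Xi$.
   Context: All structures (models) are countable. ''Formula'' always means quantifier-free $\mathcal{L}$-formula (a Boolean combination of atomic formulas); $\phi(x)$ indicates that the variables of $\phi$ are in the set $x$. $M^x$ is the set of $x$-indexed tuples of elements of $M$. Types. For a set of variables $x$, $\mathrm{S}_x(\mathcal{L})$ is the compact space of ultrafilters on the Boolean algebra of formulas in the variables $x$ modulo equivalence ($\phi_1,\phi_2$ are equivalent if they are satisfied by the same tuples in all $\mathcal{L}$-structures). Its elements are called types; $p\models\phi$ means $\phi\in p$; basic clopen sets are $[\phi]=\{p:p\models\phi\}$. For $a\in M^x$, $\mathrm{tp}(a)=\{\phi(x): M\models\phi(a)\}\in \mathrm{S}_x(\mathcal{L})$. For a $y$-tuple of terms $t(x)$, $\pi_t\colon \mathrm{S}_x(\mathcal{L})\to \mathrm{S}_y(\mathcal{L})$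 is given by $\pi_t(p)\models\phi(y)\iff p\models\phi(t(x))$; when $y\subseteq x$ and $t$ is the inclusion, write $\pi_y$ (restriction of a type to the variables $y$). Hereditary classes. A hereditary $\mathcal{L}$-class $\mathcal{F}$ is a collection of non-empty subsets $\mathrm{S}_x(\mathcal{F})\subseteq \mathrm{S}_x(\mathcal{L})$, for all finite $x$, such that $\pi_t(p)\in \mathrm{S}_y(\mathcal{F})$ for all finite $x,y$, all $y$-tuples of terms $t(x)$ and all $p\in \mathrm{S}_x(\mathcal{F})$. For countable $u$, $\mathrm{S}_u(\mathcal{F})$ is the set of $p\in \mathrm{S}_u(\mathcal{L})$ with $\pi_x(p)\in \mathrm{S}_x(\mathcal{F})$ for all finite $x\subseteq u$. A model of $\mathcal{F}$ is an $\mathcal{L}$-structure $M$ with $\mathrm{tp}(a)\in \mathrm{S}_x(\mathcal{F})$ for all finite $x$, $a\in M^x$. Put $[\phi]_{\mathcal{F}}=[\phi]\cap \mathrm{S}_x(\mathcal{F})$; $\phi(x)$ is consistent (with $\mathcal{F}$) if $[\phi]_{\mathcal{F}}\neq\emptyset$. $\mathcal{F}$ is a topological Fraïssé class if: (1) (amalgamation) for all disjoint finite $x,y_1,y_2$ (including $x=\emptyset$), $p\in \mathrm{S}_x(\mathcal{F})$, $q_i\in \mathrm{S}_{x\cup y_i}(\mathcal{F})$ with $\pi_x(q_1)=\pi_x(q_2)=p$, there is $s\in \mathrm{S}_{x\cup y_1\cup y_2}(\mathcal{F})$ with $\pi_{x\cup y_i}(s)=q_i$ for $i=1,2$; (2)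 for all finite $x$, $\mathrm{S}_x(\mathcal{F})$ is $G_\delta$ in $\mathrm{S}_x(\mathcal{L})$; (3) for all finite $x\subseteq y$ and open $U\subseteq \mathrm{S}_y(\mathcal{F})$, $\pi_x[U]$ is $F_\sigma$ in $\mathrm{S}_x(\mathcal{F})$. Codings. Fix a countable (infinite) set of variables $u$. $\Xi_0(\mathcal{L})$ is the set of $\xi\in \mathrm{S}_u(\mathcal{L})$ such that for every function symbol $F$ and every tuple $x$ of variables from $u$ of the appropriate arity there is $v\in u$ with $\xi\models F(x)=v$. Each $\xi\in\Xi_0(\mathcal{L})$ defines an $\mathcal{L}$-structure $M_\xi$: take a realization $a\in M^u$ of $\xi$ in some structure $M$ and let $M_\xi$ be the substructure $\{a(v):v\in u\}$ (well defined up to isomorphism). $\Xi_0(\mathcal{F})=\Xi_0(\mathcal{L})\cap \mathrm{S}_u(\mathcal{F})$. A set $\Xi\subseteq\Xi_0(\mathcal{F})$ is an admissible coding for models of $\mathcal{F}$ if: (1) $\Xi$ is a non-empty $G_\delta$ subset of $\Xi_0(\mathcal{F})$; (2) for every finite $x\subseteq u$, $\pi_x[\Xi]$ is open in $\mathrm{S}_x(\mathcal{F})$; (3) if $x\subseteq u$ is finite, $y$ is a finite set of variables (disjoint from $x$), and $\phi(x)$, $\psi(x,y)$ are formulas such that $[\phi]_{\mathcal{F}}\subseteq\pi_x[\Xi]$ and $\phi(x)\wedge\psi(x,y)$ is consistent, then there are $\xi\in\Xi$ and $y'\subseteq u$ with $|y'|=|y|$ such that $\xi\models\phi(x)\wedge\psi(x,y')$.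 Properties of models and types. A model $M$ of $\mathcal{F}$ is existentially closed if for all formulas $\phi(x,y)$ and $a\in M^x$: if there are a model $N\supseteq M$ of $\mathcal{F}$ and $b\in N^y$ with $N\models\phi(a,b)$, then there is $b'\in M^y$ with $M\models\phi(a,b')$. A type $p\in \mathrm{S}_x(\mathcal{F})$ is projectively isolated if there are a finite set of variables $y$ and a formula $\phi(x,y)$ with $\pi_x\big[[\phi]_{\mathcal{F}}\big]=\{p\}$. A model $M$ of $\mathcal{F}$ is projectively atomic if $\mathrm{tp}(a)$ is projectively isolated for every finite $x$ and $a\in M^x$. A model $M$ is homogeneous if for all $n$ and $a,b\in M^n$ with $\mathrm{tp}(a)=\mathrm{tp}(b)$ there is an automorphism $f$ of $M$ with $f(a)=b$.
   Formalization: Amalgamation over x=∅ is taken as joint embedding, so S_∅(F) is a single point (automatic without constants or nullary relations); otherwise uniqueness fails, e.g. L={c,P}, F all types, with P and its complement infinite and c in P or not. *)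

(* Defs.v *)
From HB Require Import structures.
From mathcomp Require Import all_boot.
From mathcomp Require Import finmap.
From mathcomp Require Import boolp classical_sets functions cardinality.
From mathcomp Require Import topology borel_hierarchy.

Set Implicit Arguments.
Unset Strict Implicit.
Unset Printing Implicit Defensive.

Local Open Scope classical_set_scope.

(* Sets of variables are represented by types: a finite set of variables is a
   finType, a disjoint union of sets of variables is a sum type, an inclusion
   x `<=` y is an injection x -> y, and the X-tuples of elements of M are the
   functions X -> M. *)

Record language := Language {
  fsym : Type;
  farity : fsym -> nat;
  rsym : Type;
  rarity : rsym -> nat
}.

Definition countable_language (L : language) : Prop :=
  countable [set: fsym L] /\ countable [set: rsym L].

Section Syntax.
Variable L : language.

Inductive term (X : Type) : Type :=
| Var of X
| App (f : fsym L) of ('I_(farity f) -> term X).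

(* Quantifier-free formulas. *)
Inductive formula (X : Type) : Type :=
| Bot
| Eq of term X & term X
| Rel (r : rsym L) of ('I_(rarity r) -> term X)
| Not of formula X
| And of formula X & formula X.

Fixpoint tsubst X Y (t : Y -> term X) (s : term Y) : term X :=
  match s with
  | Var y => t y
  | App f args => App (fun i => tsubst t (args i))
  end.

Fixpoint fsubst X Y (t : Y -> term X) (phi : formula Y) : formula X :=
  match phi with
  | Bot => Bot X
  | Eq s1 s2 => Eq (tsubst t s1) (tsubst t s2)
  | Rel r args => Rel (fun i => tsubst t (args i))
  | Not phi1 => Not (fsubst t phi1)
  | And phi1 phi2 => And (fsubst t phi1) (fsubst t phi2)
  end.

Definition frename X Y (g : Y -> X) : formula Y -> formula X :=
  fsubst (fun y => Var (g y)).

Record structure := Structure {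
  carrier :> Type;
  carrier_countable : countable [set: carrier];
  fint : forall f : fsym L, ('I_(farity f) -> carrier) -> carrier;
  rint : forall r : rsym L, ('I_(rarity r) -> carrier) -> Prop
}.

Fixpoint teval (M : structure) X (a : X -> M) (s : term X) : M :=
  match s with
  | Var x => a x
  | App f args => fint (fun i => teval a (args i))
  end.

Fixpoint sat (M : structure) X (a : X -> M) (phi : formula X) : Prop :=
  match phi with
  | Bot => False
  | Eq s1 s2 => teval a s1 = teval a s2
  | Rel r args => rint (fun i => teval a (args i))
  | Not phi1 => ~ sat a phi1
  | And phi1 phi2 => sat a phi1 /\ sat a phi2
  end.

Definition embedding (M N : structure) (h : M -> N) : Prop :=
  [/\ injective h,
      forall f (a : 'I_(farity f) -> M), h (fint a) = fint (h \o a) &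
      forall r (a : 'I_(rarity r) -> M), rint (h \o a) <-> rint a].

Definition isomorphism (M N : structure) (h : M -> N) : Prop :=
  embedding h /\ bijective h.

Definition isomorphic (M N : structure) : Prop :=
  exists h : M -> N, isomorphism h.

(* The order of the Boolean algebra of formulas modulo equivalence. *)
Definition entails X (phi psi : formula X) : Prop :=
  forall (M : structure) (a : X -> M), sat a phi -> sat a psi.

(* An ultrafilter on the quotient algebra is the same as its preimage in the
   set of formulas, which is what we use; being closed under [entails], it is
   saturated for equivalence of formulas. *)
Record ultrafilter X (p : set (formula X)) : Prop := Ultrafilter {
  ultra_bot : ~ p (Bot X);
  ultra_up : forall phi psi, entails phi psi -> p phi -> p psi;
  ultra_and : forall phi psi, p phi -> p psi -> p (And phi psi);
  ultra_not : forall phi, p phi \/ p (Not phi)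
}.

Record types X := Types {
  type_set :> formula X -> Prop;
  type_ultra : ultrafilter type_set
}.

Lemma types_eq X (p q : types X) : (forall phi, p phi <-> q phi) -> p = q.
Proof.
case: p q => [p up] [q uq] /= pq.
have e : p = q by apply/funext => phi; exact/propext/pq.
by case: _ / e uq => uq; congr Types; exact: Prop_irrelevance.
Qed.

HB.instance Definition _ X := gen_eqMixin (types X).
HB.instance Definition _ X := gen_choiceMixin (types X).

Definition basic X (phi : formula X) : set (types X) := [set p | p phi].

Lemma type_and X (p : types X) phi psi : p (And phi psi) <-> p phi /\ p psi.
Proof.
have u := type_ultra p; split=> [pa|[]]; last exact: (ultra_and u).
by split; apply: (ultra_up u _ pa) => M a [].
Qed.

Lemma type_not X (p : types X) phi : p (Not phi) <-> ~ p phi.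
Proof.
have u := type_ultra p; split=> [pn pp|np]; last by case: (ultra_not u phi).
apply: (ultra_bot u); apply: (ultra_up u _ (ultra_and u pp pn)).
by move=> M a [].
Qed.

Section TypesTopology.
Variable X : Type.

Lemma basic_cover : \bigcup_(B in range (@basic X)) id B = setT.
Proof.
apply/seteqP; split=> // p _; exists (basic (Not (Bot X))) => //.
by apply/type_not; exact: ultra_bot (type_ultra p).
Qed.

Lemma basic_join (A B : set (types X)) p :
  range (@basic X) A -> range (@basic X) B -> id A p -> id B p ->
  exists C, [/\ range (@basic X) C, id C p & id C `<=` id A `&` id B].
Proof.
move=> [phi _ <-] [psi _ <-] Ap Bp; exists (basic (And phi psi)).
split=> //; first by apply/type_and.
by move=> q /type_and.
Qed.

HB.instance Definition _ :=
  isBaseTopological.Build (types X) basic_cover basic_join.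

End TypesTopology.

Lemma tsubst_eval (M : structure) X Y (t : Y -> term X) (a : X -> M) s :
  teval a (tsubst t s) = teval (fun y => teval a (t y)) s.
Proof.
elim: s => //= f args IH; congr fint.
by apply/funext => i; exact: IH.
Qed.

Lemma fsubst_sat (M : structure) X Y (t : Y -> term X) (a : X -> M) phi :
  sat a (fsubst t phi) <-> sat (fun y => teval a (t y)) phi.
Proof.
elim: phi => //= [s1 s2|r args|phi IH|phi IH psi IH'].
- by rewrite !tsubst_eval.
- suff -> : (fun i => teval a (tsubst t (args i))) =
            (fun i => teval (fun y => teval a (t y)) (args i)) by [].
  by apply/funext => i; rewrite tsubst_eval.
- by rewrite IH.
- by rewrite IH IH'.
Qed.

Lemma pi_ultra X Y (t : Y -> term X) (p : types X) :
  ultrafilter [set phi | p (fsubst t phi)].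
Proof.
have u := type_ultra p; split=> /=.
- exact: ultra_bot.
- move=> phi psi e; apply: (ultra_up u) => M a /fsubst_sat h.
  by apply/fsubst_sat; exact: e.
- by move=> phi psi; exact: ultra_and.
- by move=> phi; exact: (ultra_not u).
Qed.

Definition pi X Y (t : Y -> term X) (p : types X) : types Y :=
  Types (pi_ultra t p).

(* The map pi_t when t is a tuple of variables; for g an inclusion of a set of
   variables into another, restriction of types. *)
Definition res X Y (g : Y -> X) : types X -> types Y :=
  pi (fun y => Var (g y)).

Lemma tp_ultra (M : structure) X (a : X -> M) : ultrafilter [set phi | sat a phi].
Proof.
split=> //=; first by move=> phi psi; apply.
by move=> phi; exact: EM.
Qed.

Definition tp (M : structure) X (a : X -> M) : types X := Types (tp_ultra a).

End Syntax.

Arguments Var {L X}.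

(* B as a subset of the topological subspace A; only used for B `<=` A. *)
Definition trace (T : Type) (A B : set T) : set (set_type A) :=
  set_val @^-1` B.
Arguments trace {T} A B.

Definition nowhere_dense (T : topologicalType) (A : set T) : Prop :=
  interior (closure A) = set0.

Definition meager (T : topologicalType) (A : set T) : Prop :=
  exists2 B : nat -> set T,
    forall n, nowhere_dense (B n) & A `<=` \bigcup_n B n.

Record hereditary_class (L : language) := HereditaryClass {
  cltypes :> forall x : finType, set (types L x);
  cltypes_nonempty : forall x : finType, @cltypes x !=set0;
  cltypes_pi : forall (x y : finType) (t : y -> term L x) (p : types L x),
    @cltypes x p -> @cltypes y (pi t p)
}.

Arguments cltypes {L} h x _.

Definition tcat M X Y (a : X -> M) (b : Y -> M) (v : X + Y) : M :=
  match v with inl x => a x | inr y => b y end.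

(* The inclusion of x U y2 into (x U y1) U y2. *)
Definition incl_r (x y1 y2 : Type) (v : x + y2) : x + y1 + y2 :=
  match v with inl i => inl (inl i) | inr j => inr j end.

Section Classes.
Variables (L : language) (F : hereditary_class L).

Definition cltypes_inf (u : choiceType) : set (types L u) :=
  [set p | forall x : {fset u}, F x (res val p)].

Definition clbasic (x : finType) (phi : formula L x) : set (types L x) :=
  basic phi `&` F x.

Definition consistent (x : finType) (phi : formula L x) : Prop :=
  clbasic phi !=set0.

Definition model (M : structure L) : Prop :=
  forall (x : finType) (a : x -> M), F x (tp a).

Definition amalgamation_over (x : finType) : Prop :=
  forall (y1 y2 : finType) (p : types L x)
         (q1 : types L (x + y1)%type) (q2 : types L (x + y2)%type),
    F x p -> F (x + y1)%type q1 -> F (x + y2)%type q2 ->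
    res inl q1 = p -> res inl q2 = p ->
    exists s, [/\ F (x + y1 + y2)%type s,
                  res inl s = q1 & res (@incl_r x y1 y2) s = q2].

Definition joint_embedding : Prop :=
  forall (y1 y2 : finType) (q1 : types L y1) (q2 : types L y2),
    F y1 q1 -> F y2 q2 ->
    exists s, [/\ F (y1 + y2)%type s, res inl s = q1 & res inr s = q2].

(* Amalgamation over the empty set of variables is understood to be joint
   embedding, without condition on the types of the empty tuple. When there are
   neither constants nor nullary relations, there is only one such type and
   joint embedding is the case of the empty set in the first conjunct: see
   [joint_embedding_pos_arity]. Otherwise, the first conjunct alone would admit
   the class of all fields (in the language of rings with inverse), which has an
   existentially closed, projectively atomic model in every positive
   characteristic. *)
Definition amalgamation : Prop :=
  (forall x : finType, amalgamation_over x) /\ joint_embedding.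

Record topological_fraisse : Prop := TopologicalFraisse {
  fraisse_amalgamation : amalgamation;
  fraisse_Gdelta : forall x : finType, Gdelta (F x);
  fraisse_Fsigma : forall (x y : finType) (U : set (types L (x + y)%type)),
    U `<=` F (x + y)%type -> open (trace (F (x + y)%type) U) ->
    Fsigma (trace (F x) (res inl @` U))
}.

Definition existentially_closed (M : structure L) : Prop :=
  forall (x y : finType) (phi : formula L (x + y)) (a : x -> M),
    (exists (N : structure L) (h : M -> N) (b : y -> N),
       [/\ model N, embedding h & sat (tcat (h \o a) b) phi]) ->
    exists b : y -> M, sat (tcat a b) phi.

Definition projectively_isolated (x : finType) (p : types L x) : Prop :=
  exists (y : finType) (phi : formula L (x + y)),
    res inl @` clbasic phi = [set p].

Definition projectively_atomic (M : structure L) : Prop :=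
  forall (x : finType) (a : x -> M), projectively_isolated (tp a).

Definition ec_proj_atomic_model (M : structure L) : Prop :=
  [/\ model M, existentially_closed M & projectively_atomic M].

End Classes.

Definition homogeneous (L : language) (M : structure L) : Prop :=
  forall (n : nat) (a b : 'I_n -> M), tp a = tp b ->
    exists2 f : M -> M, isomorphism f & f \o a = b.

Section Codings.
Variables (L : language) (u : choiceType).

Definition Xi0 : set (types L u) :=
  [set xi | forall (f : fsym L) (x : 'I_(farity f) -> u),
     exists v : u, xi (Eq (App (fun i => Var (x i))) (Var v))].

Definition Xi0_class (F : hereditary_class L) : set (types L u) :=
  Xi0 `&` cltypes_inf F (u := u).

(* M0 is isomorphic to M_xi: a is a realization of xi in M, and h is an
   isomorphism from M0 onto the substructure {a(v) : v in u} of M. The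
   structure M_xi exists and is unique up to isomorphism when xi is in Xi0, see
   [coded_by_exists] and [coded_by_unique]. *)
Definition coded_by (xi : types L u) (M0 : structure L) : Prop :=
  exists (M : structure L) (a : u -> M) (h : M0 -> M),
    [/\ tp a = xi, embedding h & range h = range a].

(* In coding_extension the injection y' stands for a set of |y| variables
   of u; it need not be disjoint from x. *)
Record admissible_coding (F : hereditary_class L) (Xi : set (types L u)) :
    Prop := AdmissibleCoding {
  coding_sub : Xi `<=` Xi0_class F;
  coding_nonempty : Xi !=set0;
  coding_Gdelta : Gdelta (trace (Xi0_class F) Xi);
  coding_open : forall x : {fset u},
    open (trace (F x) (res val @` Xi));
  coding_extension : forall (x : {fset u}) (y : finType)
      (phi : formula L x) (psi : formula L (x + y)),
    clbasic F phi `<=` res val @` Xi ->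
    consistent F (And (frename inl phi) psi) ->
    exists (xi : types L u) (y' : y -> u),
      [/\ Xi xi, injective y' &
          xi (And (frename val phi) (frename (tcat val y') psi))]
}.

End Codings.

Section Facts.
Variable L : language.

Lemma res_comp X Y Z (g : Y -> X) (h : Z -> Y) (p : types L X) :
  res h (res g p) = res (g \o h) p.
Proof.
apply: types_eq => phi; rewrite /res /=.
have u := type_ultra p.
by split; apply: (ultra_up u) => M a; rewrite !fsubst_sat.
Qed.

Lemma types_empty_unique (X : Type) (p q : types L X) :
  (X -> False) -> (forall f : fsym L, 0 < farity f) ->
  (forall r : rsym L, 0 < rarity r) -> p = q.
Proof.
move=> X0 f0 r0; apply: types_eq.
have noterm : term L X -> False.
  by elim=> [//|f args IH]; exact: IH (Ordinal (f0 f)).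
elim=> [|s s'|r args|phi IH|phi IH psi IH'].
- by split=> h; case: (ultra_bot (type_ultra _) h).
- by case: (noterm s).
- by case: (noterm (args (Ordinal (r0 r)))).
- by rewrite !type_not IH.
- by rewrite !type_and IH IH'.
Qed.

Lemma joint_embedding_pos_arity (F : hereditary_class L) :
  (forall f : fsym L, 0 < farity f) -> (forall r : rsym L, 0 < rarity r) ->
  amalgamation_over F void -> joint_embedding F.
Proof.
move=> f0 r0 am y1 y2 q1 q2 Fq1 Fq2.
pose g (y : finType) (v : void + y) : y :=
  match v with inl e => match e with end | inr j => j end.
have [p Fp] := cltypes_nonempty F void.
have uniq0 (p1 p2 : types L void) : p1 = p2 by exact: types_empty_unique.
have [] := am y1 y2 p (res (g y1) q1) (res (g y2) q2) Fp.
- exact: cltypes_pi.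
- exact: cltypes_pi.
- exact: uniq0.
- exact: uniq0.
move=> s [Fs s1 s2].
pose k (v : y1 + y2) : void + y1 + y2 :=
  match v with inl i => inl (inr i) | inr j => inr j end.
have rid (y : finType) (q : types L y) : res inr (res (g y) q) = q.
  rewrite res_comp; apply: types_eq => phi; rewrite /res /=.
  have u := type_ultra q.
  by split; apply: (ultra_up u) => M a; rewrite fsubst_sat.
exists (res k s); split; first exact: cltypes_pi.
- by rewrite res_comp -[RHS]rid -s1 res_comp.
- by rewrite res_comp -[RHS]rid -s2 res_comp.
Qed.

Lemma embedding_teval (M N : structure L) (h : M -> N) X (a : X -> M) s :
  embedding h -> teval (h \o a) s = h (teval a s).
Proof.
move=> [_ hf _]; elim: s => //= f args IH; rewrite hf; congr fint.
by apply/funext => i; exact: IH.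
Qed.

Lemma embedding_tp (M N : structure L) (h : M -> N) X (a : X -> M) :
  embedding h -> tp (h \o a) = tp a.
Proof.
move=> eh; apply: types_eq => /=; case: (eh) => hi _ hr.
elim=> //= [s1 s2|r args|phi IH|phi IH psi IH'].
- by rewrite !embedding_teval //; split=> [/hi|->].
- rewrite -hr; suff -> : (fun i => teval (h \o a) (args i)) =
    h \o (fun i => teval a (args i)) by [].
  by apply/funext => i; rewrite embedding_teval.
- by rewrite IH.
- by rewrite IH IH'.
Qed.

Lemma tp_surj_isomorphic (M N : structure L) X (a : X -> M) (b : X -> N) :
  (forall m, exists v, a v = m) -> (forall n, exists v, b v = n) ->
  tp a = tp b -> isomorphic M N.
Proof.
move=> sa sb ab.
have ab' phi : sat a phi <-> sat b phi.
  by rewrite -[sat a phi]/(tp a phi) ab.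
have abE v w : a v = a w <-> b v = b w by exact: (ab' (Eq (Var v) (Var w))).
pose va m := sval (cid (sa m)); pose vb n := sval (cid (sb n)).
have vaK m : a (va m) = m by rewrite /va; case: cid.
have vbK n : b (vb n) = n by rewrite /vb; case: cid.
pose h m := b (va m).
have hE v : h (a v) = b v by apply/abE; rewrite vaK.
exists h; split; last first.
  exists (fun n => a (vb n)) => [m|n]; last by rewrite hE vbK.
  by rewrite -[RHS]vaK; apply/abE; rewrite vbK.
split.
- by move=> m m' /abE; rewrite !vaK.
- move=> f args.
  rewrite -[fint args]vaK hE; apply: esym.
  have -> : args = a \o (va \o args) by apply/funext => i /=; rewrite vaK.
  have -> : h \o (a \o (va \o args)) = b \o (va \o args).
    by apply/funext => i /=; rewrite hE.
  apply: (ab' (Eq (App (fun i => Var (va (args i)))) (Var _))).1 => /=.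
  by rewrite vaK.
- move=> r args.
  have -> : args = a \o (va \o args) by apply/funext => i /=; rewrite vaK.
  have -> : h \o (a \o (va \o args)) = b \o (va \o args).
    by apply/funext => i /=; rewrite hE.
  exact: iff_sym (ab' (Rel (fun i => Var (va (args i))))).
Qed.

Lemma coded_by_unique (u : choiceType) (xi : types L u) (M N : structure L) :
  coded_by xi M -> coded_by xi N -> isomorphic M N.
Proof.
suff H (M0 : structure L) : coded_by xi M0 ->
    exists2 b : u -> M0, tp b = xi & forall m, exists v, b v = m.
  move=> /H[a ta sa] /H[b tb sb]; apply: (tp_surj_isomorphic sa sb).
  by rewrite ta.
move=> [M1 [a [h [ta eh ra]]]].
have ex v : exists m, h m = a v.
  have : range a (a v) by exists v.
  by rewrite -ra => -[m _ <-]; exists m.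
pose b v := sval (cid (ex v)).
have bE v : h (b v) = a v by rewrite /b; case: cid.
exists b.
  by rewrite -(embedding_tp _ eh) -ta; congr tp; apply/funext => v; exact: bE.
move=> m; have : range h (h m) by exists m.
rewrite ra => -[v _ av]; exists v; case: eh => hi _ _.
by apply: hi; rewrite bE.
Qed.

Lemma type_entails_fin X (p : types L X) n (phi : 'I_n -> formula L X) psi :
  (forall i, p (phi i)) ->
  (forall (M : structure L) (a : X -> M),
     (forall i, sat a (phi i)) -> sat a psi) -> p psi.
Proof.
move=> pphi ent; have u := type_ultra p.
pose c := foldr (@And L X) (Not (Bot L X)) [seq phi i | i <- enum 'I_n].
have cp : p c.
  rewrite /c; elim: (enum _) => [|i s IH] /=; last exact/type_and.
  by apply/type_not; exact: ultra_bot.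
apply: (ultra_up u _ cp) => M a; rewrite /c => h; apply: ent => i.
have : i \in enum 'I_n by rewrite mem_enum.
elim: (enum _) h => //= j s IH [hj hs]; rewrite inE => /orP[/eqP->//|].
exact: IH.
Qed.

Lemma coded_by_exists (u : choiceType) (xi : types L u) :
  countable [set: u] -> Xi0 xi -> exists M : structure L, coded_by xi M.
Proof.
move=> cu xi0; have U := type_ultra xi.
pose E v w := xi (Eq (Var v) (Var w)).
have Er v : E v v.
  by apply: (@type_entails_fin _ xi 0 (fun=> Bot L u)) => [[]|].
have Es v w : E v w -> E w v by apply: (ultra_up U) => M a /= ->.
have Et v w z : E v w -> E w z -> E v z.
  by move=> h1 h2; apply: (ultra_up U _ (ultra_and U h1 h2)) => M a /= [-> ->].
pose T := {C : set u | exists v, C = E v}.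
pose cls v : T := exist _ (E v) (ex_intro _ v erefl).
have clsE v w : cls v = cls w <-> E v w.
  split=> [[vw]|vw]; first by rewrite vw.
  apply: eq_exist; apply/funext => z; apply/propext; split; last exact: Et.
  exact/Et/Es.
have cls_surj (C : T) : exists v, cls v = C.
  by case: C => C [v Cv]; exists v; apply: eq_exist.
pose rep C := sval (cid (cls_surj C)).
have repK C : cls (rep C) = C by rewrite /rep; case: cid.
have cT : countable [set: T].
  suff -> : [set: T] = cls @` [set: u] by exact: card_le_trans (card_image_le _ _) cu.
  by apply/seteqP; split=> // C _; have [v <-] := cls_surj C; exists v.
pose fi f (A : 'I_(farity f) -> T) : T := cls (sval (cid (xi0 f (rep \o A)))).
pose ri r (A : 'I_(rarity r) -> T) : Prop := xi (Rel (fun i => Var (rep (A i)))).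
pose M := Structure cT fi ri.
have tE s : xi (Eq s (Var (rep (teval (cls : u -> M) s)))).
  elim: s => [v|f args IH] /=; first by apply/clsE; rewrite repK.
  set A := fun i => _; rewrite /fi; case: cid => v /= hv.
  have h1 : xi (Eq (App args) (App (fun i => Var (rep (A i))))).
    apply: (type_entails_fin IH) => N a /= h.
    by congr fint; apply/funext => i; exact: h.
  have h2 : E v (rep (cls v)) by apply/clsE; rewrite repK.
  apply: (ultra_up U _ (ultra_and U h1 (ultra_and U hv h2))) => N a /=.
  by move=> [-> [-> ->]].
exists M, M, (cls : u -> M), id; split; last 1 first.
- apply/seteqP; split=> C _; last by exists C.
  by have [v <-] := cls_surj C; exists v.
- apply: types_eq => /=.
  elim=> [|s1 s2|r args|phi IH|phi IH psi IH'] /=.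
  + by split=> // /(ultra_bot U).
  + have h1 := tE s1; have h2 := tE s2; split=> [e|e].
      rewrite e in h1.
      by apply: (ultra_up U _ (ultra_and U h1 h2)) => N a /= [-> ->].
    rewrite -[LHS]repK -[RHS]repK; apply/clsE.
    apply: (ultra_up U _ (ultra_and U e (ultra_and U h1 h2))) => N a /=.
    by move=> [e0 [<- <-]].
  + rewrite /ri; have h i := tE (args i); split=> hr.
      apply: (@type_entails_fin _ xi (rarity r).+1
        (fun j => if unlift ord0 j is Some i
                  then Eq (args i) (Var (rep (teval (cls : u -> M) (args i))))
                  else Rel (fun i => Var (rep (teval (cls : u -> M) (args i)))))).
        by move=> j; case: unliftP => [i _|_] //=; exact: h.
      move=> N a H; have := H ord0; rewrite unlift_none /=.
      congr rint; apply/funext => i.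
      by have := H (lift ord0 i); rewrite liftK /= => ->.
    apply: (@type_entails_fin _ xi (rarity r).+1
        (fun j => if unlift ord0 j is Some i
                  then Eq (args i) (Var (rep (teval (cls : u -> M) (args i))))
                  else Rel args)).
      by move=> j; case: unliftP => [i _|_] //=; exact: h.
    move=> N a H; have := H ord0; rewrite unlift_none /=.
    congr rint; apply/funext => i.
    by have := H (lift ord0 i); rewrite liftK /= => ->.
  + by rewrite IH type_not.
  + by rewrite IH IH' type_and.
- by split=> // r a.
Qed.

End Facts.

(* Main.v *)
From HB Require Import structures.
From mathcomp Require Import all_boot.
From mathcomp Require Import finmap.
From mathcomp Require Import boolp classical_sets functions cardinality.
From mathcomp Require Import topology borel_hierarchy.
Require Import Defs.

(** The theorem is a Baire category argument carried out on the codes.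

    Back-and-forth. In an existentially closed model [N], an isolating formula
    of the type of a longer tuple of [M] is realized over any tuple of [N] with
    the same type as the shorter tuple ([forth_step]). So two existentially
    closed, projectively atomic models are isomorphic, by an isomorphism that
    can be prescribed on a pair of finite tuples of the same type: this gives
    uniqueness and homogeneity.

    Existential closedness seen on types. The class need not be compact, so
    the amalgam of an infinite model with a type over a finite part of it is
    obtained as a limit of amalgams over an exhaustion by finite tuples
    ([extend_model]). It follows that [M] is existentially closed iff it
    realizes [phi(a, y)] as soon as [tp a] is the restriction of some type of
    the class satisfying [phi] ([ec_typesP]).

    Category. The space of codes is a G-delta subset of a space of ultrafilters
    on a countable algebra, hence a Baire space ([types_baire]). For a fixed
    tuple of variables and a fixed formula, the codes that satisfy the above
    requirement form a dense G-delta set: it is a G-delta because the projection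
    of an open set of types is an F-sigma, and it is dense by amalgamation and
    the extension property of codings ([Gdelta_dense_ec_at]). If the projectively
    isolated types are dense, the codes in which the type of a given tuple is
    seen to be isolated form a dense open set ([Gdelta_dense_atomic_at]); if a
    type is not projectively isolated, the codes in which a given tuple omits it
    form a dense open set ([Gdelta_dense_omit]).

    Hence, when isolated types are dense, the generic code gives an
    existentially closed and projectively atomic model, and by uniqueness the
    codes of that model are exactly the generic ones. Conversely, a model with a
    non-meager set of codes has a code in each dense G-delta set: it is
    existentially closed, and it omits every type that is not projectively
    isolated. *)

Set Implicit Arguments.
Unset Strict Implicit.
Unset Printing Implicit Defensive.

Local Open Scope classical_set_scope.

(** * Finite supports and countability of formulas *)

Section Support.
Variable L : language.

Definition trename X Y (g : Y -> X) : term L Y -> term L X :=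
  tsubst (fun y => Var (g y)).

Lemma tsubst_comp X Y Z (t : Y -> term L X) (t' : Z -> term L Y) s :
  tsubst t (tsubst t' s) = tsubst (fun z => tsubst t (t' z)) s.
Proof. by elim: s => //= f args IH; congr App; apply/funext => i; exact: IH. Qed.

Lemma fsubst_comp X Y Z (t : Y -> term L X) (t' : Z -> term L Y) phi :
  fsubst t (fsubst t' phi) = fsubst (fun z => tsubst t (t' z)) phi.
Proof.
elim: phi => //= [s s'|r args|phi ->|phi -> psi ->] //.
  by rewrite !tsubst_comp.
by congr Rel; apply/funext => i; rewrite tsubst_comp.
Qed.

Lemma frename_comp X Y Z (g : Y -> X) (h : Z -> Y) (phi : formula L Z) :
  frename g (frename h phi) = frename (g \o h) phi.
Proof. exact: fsubst_comp. Qed.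

Lemma sat_frename (M : structure L) X Y (g : Y -> X) (a : X -> M) phi :
  sat a (frename g phi) <-> sat (a \o g) phi.
Proof. exact: fsubst_sat. Qed.

(** The supports of a finite family are collected in a dependent sum. *)
Lemma finite_support_family (I : finType) X (s : I -> term L X) :
  (forall i, exists (x : finType) (g : x -> X) (s' : term L x),
     s i = trename g s') ->
  exists (x : finType) (g : x -> X) (s' : I -> term L x),
    forall i, s i = trename g (s' i).
Proof.
move=> H.
have /boolp.choice[f fP] : forall i,
    exists v : {x : finType & ((x -> X) * term L x)%type},
      s i = trename (projT2 v).1 (projT2 v).2.
  move=> i; have [x [g [s' e]]] := H i.
  by exists (existT _ x (g, s')).
exists {i : I & projT1 (f i)}, (fun v => (projT2 (f (tag v))).1 (tagged v)).
exists (fun i => trename (Tagged (fun i => projT1 (f i))) (projT2 (f i)).2) => i.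
by rewrite /trename tsubst_comp [LHS]fP.
Qed.

Lemma term_support X (s : term L X) :
  exists (x : finType) (g : x -> X) (s' : term L x), s = trename g s'.
Proof.
elim: s => [v|f args IH].
  by exists unit, (fun=> v), (Var tt).
have [x [g [s' e]]] := finite_support_family IH.
exists x, g, (App s'); rewrite /trename /=; congr App.
by apply/funext => i; exact: e.
Qed.

Lemma terms_support (I : finType) X (s : I -> term L X) :
  exists (x : finType) (g : x -> X) (s' : I -> term L x),
    forall i, s i = trename g (s' i).
Proof. by apply: finite_support_family => i; exact: term_support. Qed.

Lemma formula_support X (phi : formula L X) :
  exists (x : finType) (g : x -> X) (phi' : formula L x), phi = frename g phi'.
Proof.
elim: phi => [|s s'|r args|phi [x [g [p ->]]]|phi [x [g [p ->]]] psi].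
- by exists void, (fun v : void => match v with end), (Bot L void).
- have [x [g [t e]]] := terms_support (fun b : bool => if b then s else s').
  exists x, g, (Eq (t true) (t false)).
  by congr Eq; [exact: (e true)|exact: (e false)].
- have [x [g [t e]]] := terms_support args.
  exists x, g, (Rel t); rewrite /frename /=; congr Rel.
  by apply/funext => i; exact: e.
- by exists x, g, (Not p).
- move=> [y [h [q ->]]].
  exists (x + y)%type, (tcat g h), (And (frename inl p) (frename inr q)).
  by congr And; apply: esym; exact: frename_comp.
Qed.

End Support.

Section Countability.
Variable L : language.

Lemma countable_inj (T U : Type) (f : T -> U) :
  injective f -> countable [set: U] -> countable [set: T].
Proof.
move=> fi /countable_injP[g gi]; apply/countable_injP; exists (g \o f).
by move=> a b _ _ /= /gi e; apply: fi; apply: e; rewrite inE.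
Qed.

Lemma countable_inj_nat (T : Type) :
  countable [set: T] -> exists f : T -> nat, injective f.
Proof. by move=> /countable_injP[f fi]; exists f => a b; apply: fi; rewrite inE. Qed.

Lemma countable_enum (T : Type) : countable [set: T] -> T ->
  exists e : nat -> T, forall t, exists n, e n = t.
Proof.
move=> /countable_inj_nat[f fi] t0.
have /boolp.choice[e eP] : forall n, exists t0, forall t, f t = n -> t0 = t.
  move=> n; have [[t ft]|nt] := pselect (exists t, f t = n).
    by exists t => t' ft'; apply: fi; rewrite ft ft'.
  by exists t0 => t ft; case: nt; exists t.
by exists e => t; exists (f t); exact: eP.
Qed.

Lemma countable_ord_fun n (T : Type) :
  countable [set: T] -> countable [set: 'I_n -> T].
Proof.
move=> /countable_inj_nat[f fi].
apply: (@countable_inj _ {ffun 'I_n -> nat} (fun h => [ffun i => f (h i)])).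
  move=> h h' /ffunP e; apply/funext => i; apply: fi.
  by have := e i; rewrite !ffunE.
exact: countableP.
Qed.

Lemma eq_map_enum n (T : Type) (h h' : 'I_n -> T) :
  [seq h i | i <- enum 'I_n] = [seq h' i | i <- enum 'I_n] -> h = h'.
Proof.
move=> e; apply/funext => i.
have lt_i : i < size (enum 'I_n) by rewrite size_enum_ord.
have := congr1 (fun s => nth (h i) s i) e.
by rewrite (nth_map i) // (nth_map i) // nth_ord_enum.
Qed.

(** Terms and formulas are encoded by finite trees labelled by the codes of
    their symbols; the labels 0, 1 and 2 being taken by the logical symbols,
    relation symbols are shifted by three. *)
Fixpoint term_code (cf : fsym L -> nat) X (cx : X -> nat) (s : term L X) :
    GenTree.tree nat :=
  match s with
  | Var x => GenTree.Leaf (cx x)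
  | App f args =>
      GenTree.Node (cf f) [seq term_code cf cx (args i) | i <- enum 'I_(farity f)]
  end.

Fixpoint formula_code (cf : fsym L -> nat) (cr : rsym L -> nat)
    X (cx : X -> nat) (phi : formula L X) : GenTree.tree nat :=
  match phi with
  | Bot => GenTree.Leaf 0
  | Eq s s' => GenTree.Node 0 [:: term_code cf cx s; term_code cf cx s']
  | Not p => GenTree.Node 1 [:: formula_code cf cr cx p]
  | And p q => GenTree.Node 2 [:: formula_code cf cr cx p; formula_code cf cr cx q]
  | Rel r args =>
      GenTree.Node (cr r).+3 [seq term_code cf cx (args i) | i <- enum 'I_(rarity r)]
  end.

Lemma formula_countable X : countable_language L -> countable [set: X] ->
  countable [set: formula L X].
Proof.
move=> [/countable_inj_nat[cf cfi] /countable_inj_nat[cr cri]].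
move=> /countable_inj_nat[cx cxi].
have ti : injective (term_code cf cx).
  elim=> [x|f args IH] [y|f' args'] //=; first by case=> /cxi ->.
  case=> /cfi e; case: _ / e args' => args' /eq_map_enum e; congr App.
  by apply/funext => i; apply: IH; exact: (congr1 (@^~ i) e).
have fi : injective (formula_code cf cr cx).
  elim=> [|s s'|r args|p IH|p IH q IH'] [|t t'|r' args'|p'|p' q'] //=.
  - by case=> /ti -> /ti ->.
  - case=> /cri e; case: _ / e args' => args' /eq_map_enum e; congr Rel.
    by apply/funext => i; apply: ti; exact: (congr1 (@^~ i) e).
  - by case=> /IH ->.
  - by case=> /IH -> /IH' ->.
exact: countable_inj fi (countableP _).
Qed.

End Countability.

(** * Restrictions and limits of types *)

Section Restriction.
Variable L : language.

Lemma pi_comp X Y Z (t' : Y -> term L X) (t : Z -> term L Y) (p : types L X) :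
  pi t (pi t' p) = pi (fun z => tsubst t' (t z)) p.
Proof. by apply: types_eq => phi /=; rewrite fsubst_comp. Qed.

Lemma res_id X (p : types L X) : res id p = p.
Proof.
apply: types_eq => phi; have u := type_ultra p.
by split; apply: (ultra_up u) => M a /sat_frename.
Qed.

Lemma pi_tp (M : structure L) X Y (a : X -> M) (t : Y -> term L X) :
  pi t (tp a) = tp (fun y => teval a (t y)).
Proof. by apply: types_eq => phi; exact: fsubst_sat. Qed.

Lemma res_tp (M : structure L) X Y (a : X -> M) (g : Y -> X) :
  res g (tp a) = tp (a \o g).
Proof. exact: pi_tp. Qed.

Lemma type_refl X (p : types L X) s : p (Eq s s).
Proof. by apply: (@type_entails_fin _ _ p 0 (fun=> Bot L X)) => // -[]. Qed.

Lemma types_fin_eq X (p q : types L X) :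
  (forall (x : finType) (g : x -> X), res g p = res g q) -> p = q.
Proof.
move=> e; apply: types_eq => phi; have [x [g [psi ->]]] := formula_support phi.
by rewrite -[p _]/(res g p psi) e.
Qed.

(** The limit consists of the formulas that hold eventually. Since each formula
    has finite support, its truth value is eventually constant, which is what
    makes the limit an ultrafilter. *)
Lemma limit_type X (t : nat -> types L X) :
  (forall (x : finType) (g : x -> X),
     exists N, forall n, N <= n -> res g (t n) = res g (t N)) ->
  exists p, forall (x : finType) (g : x -> X),
    exists N, forall n, N <= n -> res g p = res g (t n).
Proof.
move=> H.
have U : ultrafilter (fun phi => exists N, forall n, N <= n -> t n phi).
  split=> /=.
  - by move=> [N /(_ N (leqnn N))]; exact: ultra_bot (type_ultra _).
  - move=> phi psi e [N h]; exists N => n /h; exact: ultra_up (type_ultra _) _ _ e.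
  - move=> phi psi [N h] [N' h']; exists (maxn N N') => n; rewrite geq_max.
    by move=> /andP[/h ? /h' ?]; apply/type_and.
  - move=> phi; have [x [g [psi ->]]] := formula_support phi.
    have [N e] := H x g.
    case: (ultra_not (type_ultra (t N)) (frename g psi)) => h.
      by left; exists N => n /e; rewrite -[t n _]/(res g (t n) psi) => ->.
    right; exists N => n /e.
    by rewrite -[t n _]/(res g (t n) (Not psi)) => ->.
exists (Types U) => x g; have [N e] := H x g; exists N => n le_n.
apply: types_eq => psi; split.
  move=> [N' h]; rewrite e // -(e (maxn N N')) ?leq_maxl //.
  exact/h/leq_maxr.
rewrite e // => h; exists N => n' le_n'.
by rewrite -[t n' _]/(res g (t n') psi) e.
Qed.

End Restriction.

(** * Realizing types in models *)

HB.instance Definition _ L X := gen_eqMixin (term L X).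
HB.instance Definition _ L X := gen_choiceMixin (term L X).

Section Realization.
Variables (L : language) (F : hereditary_class L).
Hypothesis cL : countable_language L.

Lemma coded_by_surj (u : choiceType) (xi : types L u) (M : structure L) :
  coded_by xi M <->
  exists2 b : u -> M, tp b = xi & forall m, exists v, b v = m.
Proof.
split=> [[N [a [h [ta eh ra]]]]|[b tb sb]]; last first.
  exists M, b, id; split=> //; first by split=> // r a.
  by apply/seteqP; split=> m _; [have [v <-] := sb m; exists v|exists m].
have /boolp.choice[b bE] : forall v, exists m, h m = a v.
  move=> v; have : range a (a v) by exists v.
  by rewrite -ra => -[m _ <-]; exists m.
exists b.
  by rewrite -(embedding_tp _ eh) -ta; congr tp; apply/funext => v; exact: bE.
move=> m; have : range h (h m) by exists m.
rewrite ra => -[v _ av]; exists v; case: eh => hi _ _.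
by apply: hi; rewrite bE.
Qed.

Lemma term_countable X : countable [set: X] -> countable [set: term L X].
Proof.
move=> cX; apply: (countable_inj (f := fun s => Eq s s)) => [s s' []//|].
exact: formula_countable.
Qed.

(** The terms over [X], taken as new variables, satisfy the coding condition
    that every function symbol applied to variables is equal to a variable, so
    that [coded_by_exists] provides the term model of [p]. *)
Lemma realize_type X (p : types L X) : countable [set: X] ->
  exists (N : structure L) (c : X -> N),
    tp c = p /\ forall d, exists s, d = teval c s.
Proof.
move=> cX; pose xi : types L (term L X) := pi id p.
have [M /coded_by_surj[b tb sb]] : exists M, coded_by xi M.
  apply: coded_by_exists; first exact: term_countable.
  by move=> f x; exists (App x); exact: (type_refl p).
exists M, (fun v => b (Var v)); split.
  rewrite -[LHS](res_tp b) tb /xi /res pi_comp; exact: res_id.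
move=> d; have [s <-] := sb d; exists s.
have : xi (Eq (Var s) (trename (@Var L X) s)).
  have -> : xi = pi id p by []; rewrite /= /trename tsubst_comp.
  have -> : tsubst (fun z => tsubst id (Var (Var z))) s = s; last exact: type_refl.
  by elim: s => //= f args IH; congr App; apply/funext => i; exact: IH.
by rewrite -tb /= tsubst_eval.
Qed.

(** The analogue of [cltypes_inf] for variables forming an arbitrary type and
    tuples that may have repetitions. *)
Definition locally_in X (p : types L X) : Prop :=
  forall (x : finType) (g : x -> X), F x (res g p).

Lemma model_generated X (N : structure L) (c : X -> N) :
  locally_in (tp c) -> (forall d, exists s, d = teval c s) -> model F N.
Proof.
move=> Fc gen x a.
have /boolp.choice[s sE] : forall i, exists s, a i = teval c s by [].
have [y [g [s' e]]] := terms_support s.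
have -> : tp a = pi s' (res g (tp c)).
  rewrite res_tp pi_tp; congr tp; apply/funext => i.
  by rewrite sE e /trename tsubst_eval.
exact/cltypes_pi/Fc.
Qed.

Lemma realize_locally_in X (p : types L X) : countable [set: X] ->
  locally_in p -> exists (N : structure L) (c : X -> N), tp c = p /\ model F N.
Proof.
move=> cX Fp; have [N [c [tc gen]]] := realize_type p cX.
by exists N, c; split=> //; apply: model_generated gen; rewrite tc.
Qed.

Lemma cltypes_locally_in (x : finType) (p : types L x) : F x p -> locally_in p.
Proof. by move=> Fp y g; exact: cltypes_pi. Qed.

Lemma res_congr (X Y : finType) (p : types L X) (g h : Y -> X) :
  (forall y, p (Eq (Var (g y)) (Var (h y)))) -> res g p = res h p.
Proof.
have [N [c [<- _]]] := realize_type p (countableP _).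
move=> e; rewrite !res_tp; congr tp; apply/funext => y; exact: e.
Qed.

Lemma embedding_of_tp (M N : structure L) (h : M -> N) :
  tp h = tp (id : M -> M) -> embedding h.
Proof.
move=> e.
have E phi : sat h phi <-> sat (id : M -> M) phi.
  by rewrite -[sat h phi]/(tp h phi) e.
split.
- by move=> m m'; exact: (E (Eq (Var m) (Var m'))).1.
- move=> f a; apply: esym.
  exact: (E (Eq (App (fun i => Var (a i))) (Var (fint a)))).2.
- move=> r a; exact: (E (Rel (fun i => Var (a i)))).
Qed.

End Realization.

(** * Amalgamating a model with a type *)

Section Amalgamation.
Variables (L : language) (F : hereditary_class L).
Hypotheses (cL : countable_language L) (am : amalgamation F).

(** Amalgamation over a tuple of variables that may have repetitions: copies of
    [y1] and [y2] are adjoined to [x], with the elements of [x] identified with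
    their images, and [x] is forgotten in the amalgam. *)
Lemma amalgamate (x y1 y2 : finType) (f1 : x -> y1) (f2 : x -> y2)
    (q1 : types L y1) (q2 : types L y2) :
  F y1 q1 -> F y2 q2 -> res f1 q1 = res f2 q2 ->
  exists s, [/\ F (y1 + y2)%type s, res inl s = q1, res inr s = q2 &
    forall i, s (Eq (Var (inl (f1 i))) (Var (inr (f2 i))))].
Proof.
move=> Fq1 Fq2 e.
have [||||s [Fs s1 s2]] := am.1 x y1 y2 (res f1 q1)
  (res (tcat f1 id) q1) (res (tcat f2 id) q2) (cltypes_pi _ Fq1).
- exact: cltypes_pi.
- exact: cltypes_pi.
- by rewrite res_comp.
- by rewrite res_comp e.
pose k (v : y1 + y2) : x + y1 + y2 :=
  match v with inl i => inl (inr i) | inr i => inr i end.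
exists (res k s); split; first exact: cltypes_pi.
- by rewrite res_comp -[RHS]res_id -[LHS](res_comp inl inr) s1 res_comp.
- by rewrite res_comp -[RHS]res_id -[LHS](res_comp (@incl_r x y1 y2) inr) s2 res_comp.
move=> i; have u := type_ultra s.
have h1 : s (Eq (Var (inl (inl i))) (Var (inl (inr (f1 i))))).
  have : res inl s (Eq (Var (inl i)) (Var (inr (f1 i)))); last by [].
  by rewrite s1; exact: (type_refl q1).
have h2 : s (Eq (Var (inl (inl i))) (Var (inr (f2 i)))).
  have : res (@incl_r x y1 y2) s (Eq (Var (inl i)) (Var (inr (f2 i)))); last by [].
  by rewrite s2; exact: (type_refl q2).
by apply: (ultra_up u _ (ultra_and u h1 h2)) => M a /= [-> ->].
Qed.

(** The form in which amalgamation is used below: a type [q] over [x] is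
    transported to a larger base [x']. *)
Lemma extend_base (x x' y : finType) (g : x -> x') (p : types L x')
    (q : types L (x + y)%type) :
  F x' p -> F (x + y)%type q -> res inl q = res g p ->
  exists s, [/\ F (x' + y)%type s, res inl s = p &
    res (tcat (inl \o g) inr) s = q].
Proof.
move=> Fp Fq e; have [s [Fs s1 s2 sE]] := amalgamate Fq Fp e.
pose k (v : x' + y) : x + y + x' :=
  match v with inl i => inr i | inr j => inl (inr j) end.
exists (res k s); split; first exact: cltypes_pi.
  by rewrite res_comp -s2.
rewrite res_comp -s1; apply: res_congr => // -[i|j]; last exact: type_refl.
by apply: (ultra_up (type_ultra s) _ (sE i)) => M a.
Qed.

Section Extension.
Variables (M : structure L) (modelM : model F M).
Variables (x y : finType) (a : x -> M) (e : nat -> M).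

(** The type [q] over [a] is spread over the whole model, enumerated by [e]. The
    variables are those of [q] together with one variable for each natural
    number; the stage [n] deals with the variables of rank at most [n]. As these
    always include the variable of the number 0, all variables can be retracted
    onto them; so each stage is represented by a type in all variables, in which
    the variables of higher rank repeat that one and have no meaning. *)
Definition ext_var : Type := (x + nat) + y.
Definition ext_rank (v : ext_var) : nat := if v is inl (inr k) then k else 0.
Definition base_retract n (v : x + nat) : x + 'I_n.+1 :=
  match v with inl i => inl i | inr k => inr (inord k) end.
Definition base_incl n (v : x + 'I_n.+1) : x + nat :=
  match v with inl i => inl i | inr k => inr (k : nat) end.
Definition ext_retract n (v : ext_var) : (x + 'I_n.+1) + y :=
  match v with inl v => inl (base_retract n v) | inr j => inr j end.
Definition ext_incl n (v : (x + 'I_n.+1) + y) : ext_var :=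
  match v with inl v => inl (base_incl v) | inr j => inr j end.

Lemma base_inclK n : cancel (@base_incl n) (base_retract n).
Proof. by move=> [i|k] //=; rewrite inord_val. Qed.

Lemma ext_inclK n : cancel (@ext_incl n) (ext_retract n).
Proof. by move=> [v|j] //=; rewrite base_inclK. Qed.

Lemma ext_retractK n v : ext_rank v <= n -> ext_incl (ext_retract n v) = v.
Proof. by move: v => [[i|k]|j] //= le_k; rewrite inordK. Qed.

Definition stage n (t : types L ext_var) : Prop :=
  F _ (res (@ext_incl n) t) /\
  res inl (res (@ext_incl n) t) = tp (tcat a e \o @base_incl n).

Lemma stage_start (q : types L (x + y)%type) :
  F _ q -> res inl q = tp a ->
  exists2 t, stage 0 t & res (tcat (inl \o inl) inr) t = q.
Proof.
move=> Fq qa.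
have [||//|s [Fs s1 s2]] :=
    extend_base (g := inl) (p := tp (tcat a e \o @base_incl 0)) (q := q).
- exact: modelM.
- by [].
- by rewrite res_tp qa.
have sE : res (@ext_incl 0) (res (ext_retract 0) s) = s.
  rewrite res_comp -[RHS]res_id; congr res; apply/funext => v; exact: ext_inclK.
exists (res (ext_retract 0) s); first by split; rewrite sE.
by rewrite res_comp -s2; congr res; apply/funext => -[].
Qed.

Lemma stage_step n t : stage n t -> exists2 t', stage n.+1 t' &
  forall (z : finType) (g : z -> ext_var), (forall i, ext_rank (g i) <= n) ->
    res g t' = res g t.
Proof.
move=> [Ft ta]; pose w (v : x + 'I_n.+1) := base_retract n.+1 (base_incl v).
have wE v : base_incl (w v) = base_incl v.
  by case: v => [i|k] //=; rewrite inordK // ltnW // ltnS.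
have [||//|s [Fs s1 s2]] :=
    extend_base (g := w) (p := tp (tcat a e \o @base_incl n.+1))
      (q := res (@ext_incl n) t).
- exact: modelM.
- exact: Ft.
- by rewrite res_tp ta; congr tp; apply/funext => v /=; rewrite wE.
have sE : res (@ext_incl n.+1) (res (ext_retract n.+1) s) = s.
  rewrite res_comp -[RHS]res_id; congr res; apply/funext => v; exact: ext_inclK.
exists (res (ext_retract n.+1) s); first by split; rewrite sE.
move=> z g le_g.
have -> : g = @ext_incl n \o (ext_retract n \o g) by apply/funext => i /=;
  rewrite ext_retractK.
rewrite -[LHS]res_comp -[RHS]res_comp; congr (res _ _); rewrite res_comp -s2.
by congr res; apply/funext => -[].
Qed.

(** By [stage_step], the restriction to the variables of rank at most [n] does
    not change after the stage [n], so the stages converge. *)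
Lemma extension_type (q : types L (x + y)%type) :
  F _ q -> res inl q = tp a ->
  exists p : types L ext_var, [/\ locally_in F p, res inl p = tp (tcat a e) &
    res (tcat (inl \o inl) inr) p = q].
Proof.
move=> Fq qa; have [t0 st0 t0q] := stage_start Fq qa.
have /boolp.choice[nx nxP] : forall nt : nat * types L ext_var,
    exists t', stage nt.1 nt.2 -> stage nt.1.+1 t' /\
      forall (z : finType) (g : z -> ext_var), (forall i, ext_rank (g i) <= nt.1) ->
        res g t' = res g nt.2.
  move=> [n t] /=; have [st|nst] := pselect (stage n t); last by exists t.
  by have [t' ? ?] := stage_step st; exists t'.
pose fix s n := if n is n'.+1 then nx (n', s n') else t0.
have sP n : stage n (s n).
  by elim: n => //= n IH; have [] := nxP (n, s n) IH.
have sS n (z : finType) (g : z -> ext_var) : (forall i, ext_rank (g i) <= n) ->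
    res g (s n.+1) = res g (s n).
  exact: (nxP (n, s n) (sP n)).2.
have sE N n (z : finType) (g : z -> ext_var) : (forall i, ext_rank (g i) <= N) ->
    N <= n -> res g (s n) = res g (s N).
  move=> le_g; elim: n => [|n IH]; first by rewrite leqn0 => /eqP->.
  rewrite leq_eqVlt => /predU1P[->//|le_N].
  by rewrite sS ?IH // => i; exact: leq_trans (le_g i) le_N.
have bound (z : finType) (g : z -> ext_var) : exists N, forall i, ext_rank (g i) <= N.
  exists (\max_i ext_rank (g i)) => i.
  exact: (leq_bigmax (F := fun i => ext_rank (g i))).
have [p pP] : exists p, forall (z : finType) (g : z -> ext_var),
    exists N, forall n, N <= n -> res g p = res g (s n).
  apply: limit_type => z g; have [N le_g] := bound z g.
  by exists N => n; exact: sE.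
have pE (z : finType) (g : z -> ext_var) : exists n,
    (forall i, ext_rank (g i) <= n) /\ res g p = res g (s n).
  have [N le_g] := bound z g; have [N' e'] := pP z g.
  exists (maxn N N'); split; last exact/e'/leq_maxr.
  by move=> i; exact: leq_trans (le_g i) (leq_maxl _ _).
exists p; split.
- move=> z g; have [n [le_g ->]] := pE z g.
  have -> : g = @ext_incl n \o (ext_retract n \o g) by apply/funext => i /=;
  rewrite ext_retractK.
  by rewrite -res_comp; apply: cltypes_pi; exact: (sP n).1.
- apply: types_fin_eq => z g; rewrite res_comp.
  have [n [le_g ->]] := pE z (inl \o g).
  have -> : inl \o g = @ext_incl n \o (inl \o (base_retract n \o g)).
    by apply/funext => i /=; have := ext_retractK (le_g i) => /= ->.
  rewrite -[LHS]res_comp -[LHS](res_comp inl) (sP n).2 !res_tp.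
  congr tp; apply/funext => i /=.
  by have := ext_retractK (le_g i) => /= -[->].
- have [n [_ ->]] := pE _ (tcat (inl \o inl) inr : x + y -> ext_var).
  by rewrite (sE 0) // => -[].
Qed.

End Extension.

(** The type given by [extension_type] is realized in a model; the variables
    enumerating [M] give the embedding. *)
Lemma extend_model (M : structure L) (x y : finType) (a : x -> M)
    (q : types L (x + y)%type) :
  model F M -> F _ q -> res inl q = tp a ->
  exists (N : structure L) (h : M -> N) (b : y -> N),
    [/\ model F N, embedding h & tp (tcat (h \o a) b) = q].
Proof.
move=> mM Fq qa.
(* An empty model has no enumeration; then [x] is empty too, and any model
   realizing [q] is an extension. *)
have [[m0 _]|nM] := pselect (exists m : M, True); last first.
  have [N [c [tc mN]]] :=
    realize_locally_in cL (countableP _) (cltypes_locally_in Fq).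
  have g (m : M) : x by case: nM; exists m.
  exists N, (c \o inl \o g), (c \o inr); split=> //.
    apply: embedding_of_tp; rewrite -(res_tp (c \o inl)) -(res_tp c) tc qa.
    by rewrite res_tp; congr tp; apply/funext => m; case: nM; exists m.
  rewrite -tc; congr tp; apply/funext => -[i|//]; by case: nM; exists (a i).
have [e es] := countable_enum (@carrier_countable L M) m0.
have /boolp.choice[sec secP] : forall m, exists n, e n = m by [].
have [p [Fp pM pq]] := extension_type mM e Fq qa.
have cv : countable [set: ext_var x y] by exact: (countableP (T := (x + nat + y)%type)).
have [N [c [tc mN]]] := realize_locally_in cL cv Fp.
pose h m := c (inl (inr (sec m))); exists N, h, (c \o inr); split=> //.
  apply: embedding_of_tp.
  rewrite -[LHS](res_tp (c \o inl) (inr \o sec)) -(res_tp c) tc pM res_tp.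
  by congr tp; apply/funext => m; exact: secP.
rewrite -pq -tc res_tp; congr tp; apply/funext => -[i|//] /=.
have : res inl (tp c) (Eq (Var (inr (sec (a i)))) (Var (inl i))); last by [].
by rewrite tc pM /= secP.
Qed.

(** Existential closedness without mention of extensions of [M]; see
    [ec_typesP]. *)
Definition ec_types (M : structure L) : Prop :=
  forall (x y : finType) (phi : formula L (x + y)) (a : x -> M),
    (res inl @` clbasic F phi) (tp a) -> exists b : y -> M, sat (tcat a b) phi.

Lemma ec_typesP (M : structure L) : model F M ->
  existentially_closed F M <-> ec_types M.
Proof.
move=> mM; split=> ec x y phi a.
  move=> [q [qphi Fq] qa]; apply: ec.
  have [N [h [b [mN eh tq]]]] := extend_model mM Fq qa.
  by exists N, h, b; split=> //; move: qphi; rewrite /basic /= -tq.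
move=> [N [h [b [mN eh hb]]]]; apply: ec; exists (tp (tcat (h \o a) b)) => //.
by rewrite res_tp -(embedding_tp a eh).
Qed.

(** Joint embedding yields a type of the class that satisfies [phi] and extends
    the type of the empty tuple of [M]. *)
Lemma ec_realizes (M : structure L) (y : finType) (phi : formula L y) :
  model F M -> ec_types M -> consistent F phi -> exists b : y -> M, sat b phi.
Proof.
move=> mM ec [q [qphi Fq]].
pose a (v : void) : M := match v with end.
have [s [Fs s1 s2]] := am.2 _ _ _ _ (mM _ a) Fq.
have [|b] := ec void y (frename inr phi) a.
  by exists s => //; split=> //; move: qphi; rewrite /basic /= -s2.
by move=> /sat_frename; exists b.
Qed.

End Amalgamation.

(** * Projectively isolated types *)

Section Isolated.
Variables (L : language) (F : hereditary_class L).
Hypothesis cL : countable_language L.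

Definition big_and X (I : finType) (phi : I -> formula L X) : formula L X :=
  foldr (@And L X) (Not (Bot L X)) [seq phi i | i <- enum I].

Lemma type_big_and X (p : types L X) (I : finType) (phi : I -> formula L X) :
  p (big_and phi) <-> forall i, p (phi i).
Proof.
suff H (s : seq I) : p (foldr (@And L X) (Not (Bot L X)) [seq phi i | i <- s]) <->
    forall i, i \in s -> p (phi i).
  by rewrite H; split=> h i; [apply: h; rewrite mem_enum|].
elim: s => [|j s IH] /=.
  by split=> // _; apply/type_not; exact: ultra_bot (type_ultra p).
rewrite type_and IH; split=> [[pj ps] i|h].
  by rewrite inE => /predU1P[->|/ps].
by split=> [|i si]; apply: h; rewrite inE ?eqxx // si orbT.
Qed.

(** Restriction along any map, injective or not, may replace projection in the
    definition of isolated types: the graph of the map is added to the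
    isolating formula. *)
Lemma isolated_image (x z : finType) (g : x -> z) (phi : formula L z) p :
  res g @` clbasic F phi = [set p] -> projectively_isolated F p.
Proof.
move=> e; exists z.
exists (And (frename inr phi) (big_and (fun i => Eq (Var (inl i)) (Var (inr (g i)))))).
apply/seteqP; split=> [_ [q [/type_and[qphi /type_big_and qE] Fq] <-]|_ ->].
  rewrite -e; exists (res inr q); first by split=> //; exact: cltypes_pi.
  rewrite res_comp; apply: res_congr => // i.
  by apply: (ultra_up (type_ultra q) _ (qE i)) => M a.
have [q [qphi Fq] qp] : (res g @` clbasic F phi) p by rewrite e.
exists (res (tcat g id) q); last by rewrite res_comp.
split; last exact: cltypes_pi.
apply/type_and; split; last by apply/type_big_and => i; exact: (type_refl q).
change (res inr (res (tcat g id) q) phi).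
by rewrite res_comp (res_id q).
Qed.

Lemma isolated_res (x z : finType) (g : x -> z) (p : types L z) :
  projectively_isolated F p -> projectively_isolated F (res g p).
Proof.
move=> [y [phi e]]; apply: (isolated_image (g := inl \o g) (phi := phi)).
apply/seteqP; split=> [_ [q qphi <-]|_ ->].
  have : (res inl @` clbasic F phi) (res inl q) by exists q.
  by rewrite e => /= <-; rewrite res_comp.
have [q qphi <-] : (res inl @` clbasic F phi) p by rewrite e.
by exists q => //; rewrite res_comp.
Qed.

End Isolated.

(** * Back-and-forth *)

Section BackAndForth.
Variables (L : language) (F : hereditary_class L).
Hypotheses (cL : countable_language L) (am : amalgamation F).

(** A formula [phi] isolating [tp (a, c)] is consistent with [tp a = tp b], so it
    is realized over [b]; any realization gives [d]. *)
Lemma forth_step (M N : structure L) (x y : finType) (a : x -> M) (b : x -> N)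
    (c : y -> M) :
  model F N -> projectively_atomic F M -> ec_types F N -> tp a = tp b ->
  exists d : y -> N, tp (tcat a c) = tp (tcat b d).
Proof.
move=> mN atM ecN ab; have [z [phi e]] := atM _ (tcat a c).
pose k (v : x + y + z) : x + (y + z) :=
  match v with
  | inl (inl i) => inl i | inl (inr j) => inr (inl j) | inr l => inr (inr l)
  end.
pose k' (v : x + (y + z)) : x + y + z :=
  match v with
  | inl i => inl (inl i) | inr (inl j) => inl (inr j) | inr (inr l) => inr l
  end.
have kK : k' \o k = id by apply/funext => -[[]|].
have [r [rphi Fr] rq] : (res inl @` clbasic F phi) (tp (tcat a c)) by rewrite e.
have [|d hd] := ecN x (y + z)%type (frename k phi) b.
  exists (res k' r); first split; last 1 first.
  - by rewrite res_comp -ab -[RHS](res_tp (tcat a c) inl) -rq res_comp.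
  - change (res k (res k' r) phi); by rewrite res_comp kK res_id.
  - exact: cltypes_pi.
exists (d \o inl); apply: esym; change ([set tp (tcat a c)] (tp (tcat b (d \o inl)))).
rewrite -e; exists (tp (tcat b d \o k)); first by split; [apply/sat_frename|exact: mN].
by rewrite res_tp; congr tp; apply/funext => -[].
Qed.

Lemma tp_surj_isomorphism (M N : structure L) X (a : X -> M) (b : X -> N) :
  (forall m, exists v, a v = m) -> (forall n, exists v, b v = n) ->
  tp a = tp b -> exists2 h : M -> N, isomorphism h & h \o a = b.
Proof.
move=> /boolp.choice[va vaK] /boolp.choice[vb vbK] ab.
have hE v : b (va (a v)) = b v.
  have : tp a (Eq (Var (va (a v))) (Var v)) by rewrite /= vaK.
  by rewrite ab.
exists (b \o va); last by apply/funext => v; exact: hE.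
split.
  apply: embedding_of_tp; rewrite -(res_tp b) -ab res_tp.
  by congr tp; apply/funext => m; exact: vaK.
exists (a \o vb) => [m|n] /=; last by rewrite hE.
have : tp b (Eq (Var (vb (b (va m)))) (Var (va m))) by rewrite /= vbK.
by rewrite -ab /= => ->.
Qed.

Section Graph.
Variables M N : structure L.

(** The graph of a finite partial isomorphism; graphs, unlike pairs of tuples,
    can be united along the construction. *)
Definition partial_iso (R : set (M * N)) : Prop :=
  exists (x : finType) (c : x -> M * N),
    tp (fst \o c) = tp (snd \o c) /\ R = range c.

Lemma partial_iso_chain (R : nat -> set (M * N)) :
  (forall n, partial_iso (R n)) -> (forall n, R n `<=` R n.+1) ->
  (forall m, exists n k, R k (m, n)) -> (forall n, exists m k, R k (m, n)) ->
  exists2 h : M -> N, isomorphism h & forall m n k, R k (m, n) -> h m = n.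
Proof.
move=> pR sR domR codR; pose X := {v : M * N | exists k, R k v}.
have sRle i j : i <= j -> R i `<=` R j.
  elim: j => [|j IH]; first by rewrite leqn0 => /eqP->.
  rewrite leq_eqVlt => /predU1P[->//|/IH ij]; exact: subset_trans ij (sR j).
have [|||h ih hE] := @tp_surj_isomorphism M N X (fst \o sval) (snd \o sval).
- by move=> m; have [n [k Rk]] := domR m; exists (exist _ (m, n) (ex_intro _ k Rk)).
- by move=> n; have [m [k Rk]] := codR n; exists (exist _ (m, n) (ex_intro _ k Rk)).
- apply: types_fin_eq => z g; rewrite !res_tp.
  have /boolp.choice[k kP] : forall i, exists k, R k (sval (g i)).
    by move=> i; exact: svalP (g i).
  have [x [c [tc Rc]]] := pR (\max_i k i).
  have /boolp.choice[l lP] : forall i, exists l, c l = sval (g i).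
    move=> i; have : R (\max_i k i) (sval (g i)).
      by apply: (sRle (k i)) (kP i); exact: (leq_bigmax (F := k)).
    by rewrite Rc => -[l _ <-]; exists l.
  have -> : (fst \o sval) \o g = (fst \o c) \o l by apply/funext => i /=; rewrite lP.
  have -> : (snd \o sval) \o g = (snd \o c) \o l by apply/funext => i /=; rewrite lP.
  by rewrite -!(res_tp _ l) tc.
exists h => // m n k Rk.
exact: (congr1 (@^~ (exist _ (m, n) (ex_intro _ k Rk) : X)) hE).
Qed.

Lemma partial_iso_dom (R : set (M * N)) m :
  model F N -> projectively_atomic F M -> ec_types F N -> partial_iso R ->
  exists2 R', partial_iso R' & R `<=` R' /\ exists n, R' (m, n).
Proof.
move=> mN atM ecN [x [c [tc ->]]].
have [d dE] := forth_step (fun _ : unit => m) mN atM ecN tc.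
exists (range (tcat c (fun i => (m, d i)))).
  exists (x + unit)%type, (tcat c (fun i => (m, d i))); split=> //.
  have -> : fst \o tcat c (fun i => (m, d i)) = tcat (fst \o c) (fun=> m).
    by apply/funext => -[].
  by rewrite dE; congr tp; apply/funext => -[].
split; last by exists (d tt), (inr tt).
by move=> _ [i _ <-]; exists (inl i).
Qed.

End Graph.

(** By symmetry, exchanging the components of pairs. *)
Lemma partial_iso_cod (M N : structure L) (R : set (M * N)) n :
  model F M -> projectively_atomic F N -> ec_types F M -> partial_iso R ->
  exists2 R', partial_iso R' & R `<=` R' /\ exists m, R' (m, n).
Proof.
pose sw (A B : structure L) (v : A * B) := (v.2, v.1).
have swP (A B : structure L) (S : set (A * B)) :
    partial_iso S -> partial_iso (sw A B @` S).
  move=> [x [c [tc ->]]]; exists x, (sw A B \o c); split; first exact: esym.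
  by rewrite image_comp.
move=> mM atN ecM pR.
have [R' pR' [sR [m mn]]] := partial_iso_dom n mM atN ecM (swP _ _ _ pR).
exists (sw N M @` R'); first exact: swP.
split; last by exists m, (n, m).
by move=> [m' n'] Rv; exists (n', m') => //; apply: sR; exists (m', n').
Qed.

(** Stage [k] puts the elements of code [k], if any, in the domain and in the
    range; the models may be finite or empty. *)
Lemma back_and_forth (M N : structure L) (x : finType) (a : x -> M) (b : x -> N) :
  model F M -> model F N -> ec_types F M -> ec_types F N ->
  projectively_atomic F M -> projectively_atomic F N -> tp a = tp b ->
  exists2 h : M -> N, isomorphism h & h \o a = b.
Proof.
move=> mM mN ecM ecN atM atN ab.
have [fM fMi] := countable_inj_nat (@carrier_countable L M).
have [fN fNi] := countable_inj_nat (@carrier_countable L N).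
pose good (k : nat) (R R' : set (M * N)) :=
  [/\ partial_iso R', R `<=` R',
      forall m, fM m = k -> exists n, R' (m, n) &
      forall n, fN n = k -> exists m, R' (m, n)].
have /boolp.choice[nx nxP] : forall kR : nat * set (M * N),
    exists R', partial_iso kR.2 -> good kR.1 kR.2 R'.
  move=> [k R] /=; have [pR|nR] := pselect (partial_iso R); last by exists R.
  have [R1 pR1 [sR1 R1k]] : exists2 R1, partial_iso R1 &
      R `<=` R1 /\ forall m, fM m = k -> exists n, R1 (m, n).
    have [[m mk]|nm] := pselect (exists m, fM m = k); last first.
      by exists R => //; split=> // m mk; case: nm; exists m.
    have [R1 pR1 [sR1 R1m]] := partial_iso_dom m mN atM ecN pR.
    by exists R1 => //; split=> // m' m'k; rewrite (_ : m' = m) //;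
      apply: fMi; rewrite mk.
  have [[n nk]|nn] := pselect (exists n, fN n = k); last first.
    by exists R1 => _; split=> // n nk; case: nn; exists n.
  have [R2 pR2 [sR2 R2n]] := partial_iso_cod n mM atN ecM pR1.
  exists R2 => _; split=> //; first exact: subset_trans sR1 sR2.
    by move=> m /R1k[n' ?]; exists n'; exact: sR2.
  by move=> n' n'k; rewrite (_ : n' = n) //; apply: fNi; rewrite nk.
pose R0 : set (M * N) := range (fun i => (a i, b i)).
pose fix R k := if k is k'.+1 then nx (k', R k') else R0.
have pR k : partial_iso (R k).
  elim: k => [|k IH] /=; last by have [] := nxP (k, R k) IH.
  by exists x, (fun i => (a i, b i)).
have RP k : good k (R k) (R k.+1) by exact: nxP (k, R k) (pR k).
have [||||h ih hE] := @partial_iso_chain M N R.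
- exact: pR.
- by move=> k; have [] := RP k.
- by move=> m; have [_ _ /(_ m erefl)[n ?] _] := RP (fM m); exists n, (fM m).+1.
- by move=> n; have [_ _ _ /(_ n erefl)[m ?]] := RP (fN n); exists m, (fN n).+1.
exists h => //; apply/funext => i; apply: (hE _ _ 0); by exists i.
Qed.

(** The back-and-forth starts from the empty tuples. They have the same type
    because a formula isolating that of [M] is consistent, hence realized in
    [N]. *)
Lemma ec_proj_atomic_unique (M N : structure L) :
  ec_proj_atomic_model F M -> ec_proj_atomic_model F N -> isomorphic M N.
Proof.
move=> [mM /(ec_typesP cL am mM) ecM atM] [mN /(ec_typesP cL am mN) ecN atN].
pose a (v : void) : M := match v with end.
pose b (v : void) : N := match v with end.
have [y [phi e]] := atM _ a.
have [q qphi _] : (res inl @` clbasic F phi) (tp a) by rewrite e.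
have [c cphi] := ec_realizes am mN ecN (ex_intro _ q qphi).
have ab : tp a = tp b.
  have : (res inl @` clbasic F phi) (res inl (tp c)).
    by exists (tp c) => //; split=> //; exact: mN.
  by rewrite e res_tp => /= <-; congr tp; apply/funext.
by have [h ih _] := back_and_forth mM mN ecM ecN atM atN ab; exists h.
Qed.

Lemma ec_proj_atomic_homogeneous (M : structure L) :
  ec_proj_atomic_model F M -> homogeneous M.
Proof.
move=> [mM /(ec_typesP cL am mM) ecM atM] n a b ab.
exact: (back_and_forth mM mM ecM ecM atM atM ab).
Qed.

End BackAndForth.

(** * G-delta sets and Baire spaces *)

Section Subspaces.
Variable T : topologicalType.

Lemma set_type_intro (A : set T) x : A x -> exists a : set_type A, set_val a = x.
Proof. by move=> Ax; exists (exist _ x (mem_set Ax)). Qed.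

Lemma set_type_elim (A : set T) (a : set_type A) : A (set_val a).
Proof. by case: a => a Aa; exact: set_mem. Qed.

Lemma open_traceP (A : set T) (W : set (set_type A)) :
  open W <-> exists2 U, open U & W = trace A U.
Proof. by split=> [[U oU <-]|[U oU ->]]; exists U. Qed.

(** Covers both [Gdelta], with [P] the open sets, and [Gdelta_dense], with [P] the
    dense open sets. *)
Definition capN (P : set T -> Prop) (S : set T) : Prop :=
  exists2 U : nat -> set T, forall n, P (U n) & S = \bigcap_n U n.

Lemma capN_forall (P : set T -> Prop) (I : Type) (S : I -> set T) :
  countable [set: I] -> P setT -> (forall i, capN P (S i)) ->
  capN P [set t | forall i, S i t].
Proof.
move=> cI PT PS; have [[i0 _]|nI] := pselect (exists i : I, True); last first.
  exists (fun=> setT) => //; apply/seteqP; split=> // t _ i.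
  by case: nI; exists i.
have [e eP] := countable_enum cI i0.
have /boolp.choice[U UP] : forall i, exists U : nat -> set T,
    (forall n, P (U n)) /\ S i = \bigcap_n U n.
  by move=> i; have [U] := PS i; exists U.
exists (fun m => if (choice.unpickle m : option (nat * nat)) is Some (j, n)
  then U (e j) n else setT).
  by move=> m; case: choice.unpickle => // -[j n]; exact: (UP _).1.
apply/seteqP; split=> t.
  move=> h m _; case: choice.unpickle => // -[j n].
  by have := h (e j); rewrite (UP _).2; exact.
move=> h i; rewrite (UP _).2 => n _; have [j <-] := eP i.
by have := h (choice.pickle (j, n)) Logic.I; rewrite choice.pickleK.
Qed.

Lemma Gdelta_denseW (S : set T) : Gdelta_dense S -> Gdelta S.
Proof. by move=> [U UP ->]; exists U => // n; exact: (UP n).1. Qed.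

Lemma dense_setT : dense [set: T].
Proof. by move=> O O0 _; rewrite setIT. Qed.

Lemma sub_dense (A B : set T) : A `<=` B -> dense A -> dense B.
Proof. by move=> AB dA O O0 oO; have [t [Ot /AB ?]] := dA O O0 oO; exists t. Qed.

Lemma Gdelta_dense_forall (I : Type) (S : I -> set T) :
  countable [set: I] -> (forall i, Gdelta_dense (S i)) ->
  Gdelta_dense [set t | forall i, S i t].
Proof.
move=> cI; apply: (@capN_forall (fun U => open U /\ dense U)) => //.
by split; [exact: openT|exact: dense_setT].
Qed.

Lemma Gdelta_forall (I : Type) (S : I -> set T) :
  countable [set: I] -> (forall i, Gdelta (S i)) ->
  Gdelta [set t | forall i, S i t].
Proof. by move=> cI; apply: (@capN_forall open) => //; exact: openT. Qed.

Lemma open_dense_Gdelta_dense (S : set T) : open S -> dense S -> Gdelta_dense S.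
Proof. by move=> oS dS; exists (fun=> S) => //; rewrite bigcap_const. Qed.

Lemma setI_forall (A B : set T) :
  A `&` B = [set t | forall b : bool, (if b then A else B) t].
Proof.
apply/seteqP; split=> t; first by move=> [? ?] [].
by move=> h; split; [exact: h true|exact: h false].
Qed.

Lemma Gdelta_denseI (A B : set T) :
  Gdelta_dense A -> Gdelta_dense B -> Gdelta_dense (A `&` B).
Proof. by rewrite setI_forall => ? ?; apply: Gdelta_dense_forall => // -[]. Qed.

Lemma GdeltaI (A B : set T) : Gdelta A -> Gdelta B -> Gdelta (A `&` B).
Proof. by rewrite setI_forall => ? ?; apply: Gdelta_forall => // -[]. Qed.

Definition baire : Prop := forall S : set T, Gdelta_dense S -> dense S.

(** The complement of a dense open set is nowhere dense. *)
Lemma nonmeager_meets (A S : set T) :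
  ~ meager A -> Gdelta_dense S -> A `&` S !=set0.
Proof.
move=> nA [U UP ->]; apply: contrapT => /nonemptyPn AS; apply: nA.
exists (fun n => ~` U n) => [n|t At].
  rewrite /nowhere_dense closure_setC interiorC.
  rewrite (_ : closure _ = setT) ?setCT //.
  have [oU dU] := UP n; apply/seteqP; split=> // t _ B.
  rewrite nbhsE => -[O [oO Ot] OB].
  have [s [Os Us]] := dU O (ex_intro _ t Ot) oO.
  by exists s; split; [move: oU => /interior_id ->|exact: OB].
apply: contrapT => nB; suff : set0 t by [].
by rewrite -AS; split=> // n _; apply: contrapT => nU; apply: nB; exists n.
Qed.

Lemma Gdelta_dense_nonmeager (S : set T) :
  baire -> [set: T] !=set0 -> Gdelta_dense S -> ~ meager S.
Proof.
move=> bT T0 gS [B ndB SB].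
have gB : Gdelta_dense [set t | forall n, (~` closure (B n)) t].
  apply: Gdelta_dense_forall => [|n]; first exact: countableP.
  apply: open_dense_Gdelta_dense; first exact/closed_openC/closed_closure.
  move=> O [t Ot] oO; apply: contrapT => /nonemptyPn OB.
  suff : interior (closure (B n)) t by rewrite ndB.
  rewrite /interior nbhsE; exists O => // s Os; apply: contrapT => nB.
  suff : set0 s by [].
  by rewrite -OB.
have [t [_ [/SB[n _ Bnt] nB]]] := bT _ (Gdelta_denseI gS gB) setT T0 openT.
by apply: (nB n); exact: subset_closure.
Qed.

Lemma dense_Gdelta_dense (S : set T) : dense S -> Gdelta S -> Gdelta_dense S.
Proof.
move=> dS [U oU SE]; exists U => // n; split; first exact: oU.
by apply: sub_dense dS; rewrite SE => t; exact.
Qed.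

End Subspaces.

(** * Spaces of types *)

Section TypeSpaces.
Variable L : language.

Lemma open_typesP X (U : set (types L X)) :
  open U <-> forall p, U p -> exists2 phi, p phi & basic phi `<=` U.
Proof.
have ob phi : open (basic phi : set (types L X)).
  exists [set basic phi]; last by rewrite bigcup_set1.
  by move=> B ->; exists phi.
split=> [[D sD <-] p [B DB Bp]|h].
  have [phi _ phiB] := sD B DB; move: Bp; rewrite -phiB => pphi.
  by exists phi => // q qphi; exists B => //; rewrite -phiB.
have -> : U = \bigcup_(phi in [set phi | basic phi `<=` U]) basic phi.
  apply/seteqP; split=> [p Up|p [phi sU]]; last exact: sU.
  by have [phi ? ?] := h p Up; exists phi.
by apply: bigcup_open => phi _.
Qed.

Lemma open_basic X (phi : formula L X) : open (basic phi).
Proof. by apply/open_typesP => p pphi; exists phi. Qed.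

Lemma open_res X Y (g : Y -> X) (U : set (types L Y)) :
  open U -> open (res g @^-1` U).
Proof.
move=> /open_typesP oU; apply/open_typesP => p /oU[phi pphi sU].
by exists (frename g phi) => // q qphi; exact: sU.
Qed.

Lemma Gdelta_res X Y (g : Y -> X) (S : set (types L Y)) :
  Gdelta S -> Gdelta (res g @^-1` S).
Proof.
move=> [U oU ->]; exists (fun n => res g @^-1` U n) => [n|].
  exact: open_res.
by rewrite preimage_bigcap.
Qed.

Lemma Gdelta_subspace X (A B : set (types L X)) :
  B `<=` A -> Gdelta A -> Gdelta (trace A B) -> Gdelta B.
Proof.
move=> BA gA [W oW BW].
have /boolp.choice[U UP] : forall n, exists U, open U /\ W n = trace A U.
  by move=> n; have /open_traceP[U] := oW n; exists U.
have -> : B = A `&` \bigcap_n U n; last first.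
  by apply: GdeltaI => //; exists U => // n; exact: (UP n).1.
apply/seteqP; split=> p.
  move=> Bp; split; first exact: BA.
  have [a ap] := set_type_intro (BA _ Bp).
  have : trace A B a by rewrite /trace /preimage /= ap.
  by rewrite BW => h n _; have := h n I; rewrite (UP n).2 /trace /preimage /= ap.
move=> [Ap Up]; have [a ap] := set_type_intro Ap.
suff : trace A B a by rewrite /trace /preimage /= ap.
by rewrite BW => n _; rewrite (UP n).2 /trace /preimage /= ap; exact: Up.
Qed.

Lemma type_separation X (p q : types L X) : p <> q -> exists2 phi, p phi & ~ q phi.
Proof.
move=> pq; apply: contrapT => /forall2NP h; apply: pq; apply: types_eq => phi.
have E psi : p psi -> q psi by move=> pp; case: (h psi) => // /contrapT.
split; first exact: E.
move=> qphi; apply: contrapT => /type_not np.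
by have /type_not := E _ np.
Qed.

(** Given dense open sets [D n] of [G] and [G] the intersection of open sets
    [O n], one builds stronger and stronger formulas [th n], each satisfied by
    some point of [G], such that [th n.+1] implies membership in [O n] and in
    [D n] and decides the formula number [n]. The last requirement makes the
    formulas implied by some [th n] an ultrafilter, which stands for an appeal
    to compactness; this point lies in [G] and in every [D n]. *)
Lemma types_baire X (G : set (types L X)) :
  countable_language L -> countable [set: X] -> Gdelta G ->
  baire (set_type G).
Proof.
move=> cL cX [O oO GO] _ [D DP ->] W [w Ww] /open_traceP[V oV WV].
have GE q : G q -> forall n, O n q by rewrite GO => h n; exact: h.
have /boolp.choice[U UP] : forall n, exists U, open U /\ D n = trace G U.
  by move=> n; have /open_traceP[U] := (DP n).1; exists U.
have [e eP] := countable_enum (formula_countable cL cX) (Bot L X).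
pose ok (theta : formula L X) := exists2 xi, G xi & xi theta.
have /boolp.choice[nx nxP] : forall nt : nat * formula L X, exists theta,
    ok nt.2 -> [/\ ok theta, entails theta nt.2,
      basic theta `<=` O nt.1 `&` U nt.1 &
      entails theta (e nt.1) \/ entails theta (Not (e nt.1))].
  move=> [n theta] /=; have [[xi Gxi xit]|nok] := pselect (ok theta); last first.
    by exists theta.
  have [a axi] := set_type_intro Gxi.
  have [||z [zt]] := (DP n).2 (trace G (basic theta)).
  - by exists a; rewrite /trace /preimage /= axi.
  - by apply/open_traceP; exists (basic theta) => //; exact: open_basic.
  rewrite (UP n).2 => Uz; have Gz := set_type_elim z.
  have Oz : O n (set_val z) by exact: GE.
  have /open_typesP/(_ _ Oz)[phi1 zphi1 s1] := oO n.
  have /open_typesP/(_ _ Uz)[phi2 zphi2 s2] := (UP n).1.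
  have [chi zchi chiP] : exists2 chi, (set_val z : types L X) chi &
      entails chi (e n) \/ entails chi (Not (e n)).
    case: (ultra_not (type_ultra (set_val z)) (e n)) => h.
      by exists (e n) => //; left.
    by exists (Not (e n)) => //; right.
  exists (And theta (And phi1 (And phi2 chi))) => _; split.
  - by exists (set_val z) => //; rewrite !type_and.
  - by move=> M b [].
  - by move=> p /type_and[_ /type_and[/s1 ? /type_and[/s2 ? _]]].
  - by case: chiP => h; [left|right] => M b [_ [_ [_]]]; exact: h.
have Vw : V (set_val w) by move: Ww; rewrite WV.
have /open_typesP/(_ _ Vw)[theta0 w0 s0] := oV.
pose fix th n := if n is n'.+1 then nx (n', th n') else theta0.
have thok n : ok (th n).
  elim: n => [|n IH] /=; last by have [] := nxP (n, th n) IH.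
  by exists (set_val w) => //; exact: set_type_elim.
have thS n : [/\ entails (th n.+1) (th n), basic (th n.+1) `<=` O n `&` U n &
    entails (th n.+1) (e n) \/ entails (th n.+1) (Not (e n))].
  by have [] := nxP (n, th n) (thok n).
have thle m n : m <= n -> entails (th n) (th m).
  elim: n => [|n IH]; first by rewrite leqn0 => /eqP->.
  rewrite leq_eqVlt => /predU1P[-> //|/IH mn] M b h; apply: mn.
  by have [h' _ _] := thS n; exact: h'.
have u : ultrafilter (fun phi => exists n, entails (th n) phi).
  split=> /=.
  - move=> [n h]; have [xi _ xit] := thok n.
    exact: ultra_bot (type_ultra xi) (ultra_up (type_ultra xi) h xit).
  - by move=> phi psi h [n h']; exists n => M b /h'; exact: h.
  - move=> phi psi [n h] [n' h']; exists (maxn n n') => M b hb.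
    by split; [apply/h/(thle _ (maxn n n'))|apply/h'/(thle _ (maxn n n'))] => //;
      rewrite ?leq_maxl ?leq_maxr.
  - by move=> phi; have [n <-] := eP phi; have [_ _ []] := thS n => h; [left|right];
      exists n.+1.
pose p := Types u.
have pth n : p (th n) by exists n.
have pOU n : O n p /\ U n p by have [_ h _] := thS n; exact: (h p (pth n.+1)).
have Gp : G p by rewrite GO => n _; exact: (pOU n).1.
have [a ap] := set_type_intro Gp.
exists a; split.
  by rewrite WV /trace /preimage /= ap; apply: s0; exact: (pth 0).
by move=> n _; rewrite (UP n).2 /trace /preimage /= ap; exact: (pOU n).2.
Qed.

End TypeSpaces.

(** * Spaces of codes *)

Section Locality.
Variables (L : language) (F : hereditary_class L).

Lemma finite_image (u : choiceType) (x : finType) (g : x -> u) :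
  exists (A : {fset u}) (g' : x -> A), g = val \o g'.
Proof.
pose A := seq_fset tt (codom g).
have gA i : g i \in A by rewrite seq_fsetE codom_f.
by exists A, (fun i => FSetSub (gA i)); apply/funext.
Qed.

Lemma cltypes_inf_locally_in (u : choiceType) (p : types L u) :
  cltypes_inf F p <-> locally_in F p.
Proof.
split=> [Fp x g|Fp A]; last exact: Fp.
have [A [g' ->]] := finite_image g.
by rewrite -res_comp; exact/cltypes_pi/Fp.
Qed.

(** There are only countably many finite tuples indexed by ordinals. *)
Lemma locally_in_ord X (p : types L X) :
  locally_in F p <-> forall k (g : 'I_k -> X), F 'I_k (res g p).
Proof.
split=> [Fp k g|Fp x g]; first exact: Fp.
have -> : g = (g \o enum_val) \o enum_rank.
  by apply/funext => i /=; rewrite enum_rankK.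
by rewrite -res_comp; exact/cltypes_pi/Fp.
Qed.

End Locality.

Section Coding.
Variables (L : language) (u : choiceType) (F : hereditary_class L).
Variable Xi : set (types L u).
Hypotheses (cL : countable_language L) (cu : countable [set: u]).
Hypotheses (fraisseF : topological_fraisse F) (codingXi : admissible_coding F Xi).

Let am := fraisse_amalgamation fraisseF.

Lemma Gdelta_locally_in : Gdelta [set p : types L u | locally_in F p].
Proof.
have -> : [set p : types L u | locally_in F p] =
    [set p | forall k (g : 'I_k -> u), (res g @^-1` F 'I_k) p].
  by apply/seteqP; split=> p /locally_in_ord.
apply: Gdelta_forall => [|k]; first exact: countableP.
apply: Gdelta_forall => [|g]; first exact: countable_ord_fun.
exact/Gdelta_res/fraisse_Gdelta.
Qed.

Lemma Gdelta_Xi0 : Gdelta (@Xi0 L u).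
Proof.
apply: Gdelta_forall => [|f]; first exact: cL.1.
apply: Gdelta_forall => [|x]; first exact: countable_ord_fun.
apply/open_Gdelta/open_typesP => p [v pv].
by exists (Eq (App (fun i => Var (x i))) (Var v)) => // q qv; exists v.
Qed.

Lemma Gdelta_coding : Gdelta Xi.
Proof.
apply: (Gdelta_subspace (coding_sub codingXi)); last exact: coding_Gdelta.
apply: GdeltaI; first exact: Gdelta_Xi0.
have -> : cltypes_inf F (u := u) = [set p | locally_in F p].
  by apply/seteqP; split=> p /cltypes_inf_locally_in.
exact: Gdelta_locally_in.
Qed.

Lemma coding_baire : baire (set_type Xi).
Proof. exact: types_baire cL cu Gdelta_coding. Qed.

Lemma coding_inhabited : [set: set_type Xi] !=set0.
Proof.
by have [xi /set_type_intro[a _]] := coding_nonempty codingXi; exists a.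
Qed.

Lemma coding_locally_in xi : Xi xi -> locally_in F xi.
Proof. by move=> /(coding_sub codingXi)[_ /cltypes_inf_locally_in]. Qed.

Lemma coded_by_model xi (M : structure L) : Xi xi -> coded_by xi M -> model F M.
Proof.
move=> /coding_locally_in Fxi /coded_by_surj[b tb sb].
apply: (model_generated (c := b)); first by rewrite tb.
by move=> d; have [v <-] := sb d; exists (Var v).
Qed.

Lemma coding_exists xi : Xi xi -> exists M : structure L, coded_by xi M.
Proof. by move=> /(coding_sub codingXi)[/(coded_by_exists cu)]. Qed.

(** Since [Xi] has open projections, an open condition on a code can be
    strengthened to a formula [phi] whose realizations in the class all extend
    to codes. *)
Lemma refine_condition (x : finType) (g : x -> u) xi theta : Xi xi -> xi theta ->
  exists (A : {fset u}) (g' : x -> A) (phi : formula L A),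
    [/\ g = val \o g', xi (frename val phi), clbasic F phi `<=` res val @` Xi &
        forall zeta : types L u, zeta (frename val phi) -> zeta theta].
Proof.
move=> Xxi xit; have [y [h [theta' thetaE]]] := formula_support theta.
have [A [k kE]] := finite_image (tcat g h).
have [U /open_typesP oU UE] := (open_traceP _).1 (coding_open codingXi A).
have UP (q : types L A) : F A q -> U q <-> (res val @` Xi) q.
  move=> Fq; have [a aq] := set_type_intro Fq.
  have : trace (F A) U a <-> trace (F A) (res val @` Xi) a by rewrite UE.
  by rewrite /trace /preimage /= aq.
have Fxi : F A (res val xi) by exact: coding_locally_in.
have /oU[phi xiphi sU] : U (res val xi) by apply/UP => //; exists xi.
have hE : frename val (frename (k \o inr) theta') = theta.
  rewrite thetaE frename_comp; congr frename; apply/funext => i.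
  exact: (esym (congr1 (@^~ (inr i)) kE)).
exists A, (k \o inl), (And phi (frename (k \o inr) theta')); split.
- by apply/funext => i; exact: (congr1 (@^~ (inl i)) kE).
- by apply/type_and; split=> //; move: xit; rewrite -hE.
- by move=> q [/type_and[/sU Uq _] Fq]; apply/UP.
- by move=> zeta /type_and[_]; rewrite -[in zeta theta]hE.
Qed.

(** The density criterion for sets of codes: only the conditions produced by
    [refine_condition] matter, and their variables may be assumed to include
    the tuple [g]. *)
Lemma dense_by_conditions (x : finType) (g : x -> u) (D : set (types L u)) :
  (forall (A : {fset u}) (g' : x -> A) (phi : formula L A) xi,
     g = val \o g' -> Xi xi -> xi (frename val phi) ->
     clbasic F phi `<=` res val @` Xi ->
     exists2 zeta, Xi zeta & zeta (frename val phi) /\ D zeta) ->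
  dense (trace Xi D).
Proof.
move=> H W [w Ww] /open_traceP[V /open_typesP oV WV].
have /oV[theta wt sV] : V (set_val w) by move: Ww; rewrite WV.
have Xw := set_type_elim w.
have [A [g' [phi [gE wphi sphi impl]]]] := refine_condition g Xw wt.
have [zeta Xz [zphi Dz]] := H A g' phi _ gE Xw wphi sphi.
have [a az] := set_type_intro Xz; exists a.
rewrite WV /trace /preimage /=; split; rewrite /= az //.
exact/sV/impl.
Qed.

(** * Dense sets of codes *)

Section Tasks.
Variables (x : finType) (g : x -> u).

(** The instance of [ec_types] for the tuple named by [g] and the formula
    [phi]. *)
Definition ec_at (y : finType) (phi : formula L (x + y)) : set (types L u) :=
  [set xi | (res inl @` clbasic F phi) (res g xi) ->
            exists h : y -> u, xi (frename (tcat g h) phi)].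

(** Let [phi0] be a condition satisfied by the code [xi]. If [xi] does not
    already belong to the set, some type [q] satisfying [phi] agrees with [xi]
    on [g]; amalgamating them shows that [phi0] is consistent with [phi], and the
    extension property gives a code that satisfies both. *)
Lemma dense_ec_at (y : finType) (phi : formula L (x + y)) :
  dense (trace Xi (ec_at phi)).
Proof.
apply: (dense_by_conditions (g := g)) => A g' phi0 xi gE Xxi xi0 s0.
have [im|nim] := pselect ((res inl @` clbasic F phi) (res g xi)); last first.
  by exists xi => //; split=> // /nim.
have [q [qphi Fq] qxi] := im.
have FA : F A (res val xi) by exact: coding_locally_in.
have [|s [Fs s1 s2]] := extend_base cL am (g := g') FA Fq.
  by rewrite qxi gE res_comp.
have [|zeta [y' [Xz _ /type_and[z0 zpsi]]]] :=
    coding_extension codingXi (psi := frename (tcat (inl \o g') inr) phi) s0.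
  exists s; split=> //; apply/type_and; split.
    by rewrite -[s _]/(res inl s phi0) s1.
  by rewrite -[s _]/(res (tcat (inl \o g') inr) s phi) s2.
exists zeta => //; split=> // _; exists y'.
move: zpsi; rewrite frename_comp; congr (type_set zeta (frename _ phi)).
by rewrite gE; apply/funext => -[].
Qed.

(** The hypothesis of [ec_at phi] says that the type of [g] lies in the
    projection of an open set, which is a union of closed sets [K m]. Replacing
    the projection by [K m] gives an open set, which is dense because it
    contains [ec_at phi]. *)
Lemma Gdelta_dense_ec_at (y : finType) (phi : formula L (x + y)) :
  Gdelta_dense (trace Xi (ec_at phi)).
Proof.
have [||K cK KE] := fraisse_Fsigma fraisseF (U := clbasic F phi).
- by move=> q [].
- apply/open_traceP; exists (basic phi); first exact: open_basic.
  apply/seteqP; split=> a; first by case.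
  by move=> aphi; split=> //; exact: set_type_elim.
have /boolp.choice[V VP] : forall m, exists V, open V /\ ~` K m = trace (F x) V.
  move=> m; have /open_traceP[V] : open (~` K m) by exact: closed_openC.
  by exists V.
have imP (q : types L x) : F x q ->
    (res inl @` clbasic F phi) q <-> exists m, ~ V m q.
  move=> Fq; have [a aq] := set_type_intro Fq.
  have -> : (res inl @` clbasic F phi) q <-> (\bigcup_m K m) a.
    by rewrite -KE /trace /preimage /= aq.
  have KV m : K m a <-> ~ V m q.
    have : (~` K m) a <-> V m q by rewrite (VP m).2 /trace /preimage /= aq.
    by move=> <-; rewrite /setC /= notK.
  by split=> [[m _ /KV]|[m /KV]]; exists m.
exists (fun m => trace Xi [set xi | V m (res g xi) \/
    exists h : y -> u, xi (frename (tcat g h) phi)]).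
  move=> m; split.
    apply/open_traceP; eexists; last by [].
    apply/open_typesP => p [Vp|[h ph]].
      have /open_typesP/(_ p Vp)[psi ppsi sV] := open_res g (VP m).1.
      by exists psi => // q /sV; left.
    by exists (frename (tcat g h) phi) => // q qh; right; exists h.
  apply: sub_dense (dense_ec_at phi) => a; rewrite /trace /preimage /= => eca.
  have Fa : F x (res g (set_val a)) by exact: (coding_locally_in (set_type_elim a)).
  have [Va|nVa] := pselect (V m (res g (set_val a))); first by left.
  by right; apply: eca; apply/imP => //; exists m.
apply/seteqP; split=> a; rewrite /trace /preimage /= => ha.
  move=> m _ /=; have Fa : F x (res g (set_val a)).
    exact: (coding_locally_in (set_type_elim a)).
  have [Va|nVa] := pselect (V m (res g (set_val a))); first by left.
  by right; apply: ha; apply/imP => //; exists m.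
have Fa : F x (res g (set_val a)) by exact: (coding_locally_in (set_type_elim a)).
by move=> /(imP _ Fa)[m nV]; case: (ha m Logic.I).
Qed.

(** A finite part of the code isolates the type of the tuple [g]. That this type
    be isolated is a weaker condition, in general not an open one; the two
    agree when the coded model is existentially closed. *)
Definition atomic_at : set (types L u) :=
  [set xi | exists (z : finType) (phi : formula L z) (f : x -> z) (h : z -> u),
     [/\ g = h \o f, exists p, res f @` clbasic F phi = [set p] &
         xi (frename h phi)]].

Lemma atomic_at_isolated xi : Xi xi -> atomic_at xi ->
  projectively_isolated F (res g xi).
Proof.
move=> Xxi [z [phi [f [h [gE [p e] xiphi]]]]].
have <- : p = res g xi.
  apply: esym; change ([set p] (res g xi)); rewrite -e; exists (res h xi).
    by split=> //; exact: coding_locally_in.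
  by rewrite res_comp gE.
exact: isolated_image cL _ _ _ _ _ e.
Qed.

(** A condition [phi0] on the variables [A] contains an isolated type, hence is
    consistent with an isolating formula [psi]; a code that satisfies both has
    an isolated type on [A], hence on [g]. *)
Lemma Gdelta_dense_atomic_at :
  (forall z : finType, dense (trace (F z) [set p | projectively_isolated F p])) ->
  Gdelta_dense (trace Xi atomic_at).
Proof.
move=> iso; apply: open_dense_Gdelta_dense.
  apply/open_traceP; exists atomic_at => //; apply/open_typesP => xi.
  move=> [z [phi [f [h [gE e xiphi]]]]].
  by exists (frename h phi) => // zeta zphi; exists z, phi, f, h.
apply: (dense_by_conditions (g := g)) => A g' phi0 xi gE Xxi xi0 s0.
have [a axi] := set_type_intro (coding_locally_in Xxi val : F A (res val xi)).
have [||b [b0 [y [psi e]]]] := iso A (trace (F A) (basic phi0)).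
- by exists a; rewrite /trace /preimage /= axi.
- by apply/open_traceP; exists (basic phi0) => //; exact: open_basic.
have [q [qpsi Fq] qb] : (res inl @` clbasic F psi) (set_val b) by rewrite e.
have [|zeta [y' [Xz _ /type_and[z0 zpsi]]]] :=
    coding_extension codingXi (psi := psi) s0.
  exists q; split=> //; apply/type_and; split=> //.
  by rewrite -[q _]/(res inl q phi0) qb.
exists zeta => //; split=> //.
exists (A + y)%type, psi, (inl \o g'), (tcat val y'); split=> //.
exists (res g' (set_val b)); apply/seteqP; split=> [_ [r rpsi <-]|_ ->].
  have : (res inl @` clbasic F psi) (res inl r) by exists r.
  by rewrite e => /= <-; rewrite res_comp.
by exists q => //; rewrite -qb res_comp.
Qed.

(** Omitting types: if all codes satisfying a condition [phi0] realized [p] at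
    [g], then [phi0] would isolate [p]. *)
Lemma Gdelta_dense_omit (p : types L x) : ~ projectively_isolated F p ->
  Gdelta_dense (trace Xi [set xi | res g xi <> p]).
Proof.
move=> niso; apply: open_dense_Gdelta_dense.
  apply/open_traceP; exists [set xi | res g xi <> p] => //.
  apply/open_typesP => xi /type_separation[phi xiphi nphi].
  by exists (frename g phi) => // zeta zphi e; apply: nphi; rewrite -e.
apply: (dense_by_conditions (g := g)) => A g' phi0 xi gE Xxi xi0 s0.
apply: contrapT => nz; apply: niso.
have resp (q : types L A) : clbasic F phi0 q -> res g' q = p.
  move=> hq; have [zeta Xz zq] := s0 q hq; apply: contrapT => qp; apply: nz.
  exists zeta => //; split; last by rewrite /= gE -res_comp zq.
  by rewrite -[zeta _]/(res val zeta phi0) zq; case: hq.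
apply: (isolated_image cL (g := g') (phi := phi0)).
apply/seteqP; split=> [_ [q hq <-]|_ ->]; first exact: resp.
have hxi : clbasic F phi0 (res val xi) by split=> //; exact: coding_locally_in.
by exists (res val xi) => //; exact: resp.
Qed.

End Tasks.

(** * Models of generic codes *)

Definition ec_codes : set (types L u) :=
  [set xi | forall k (g : 'I_k -> u) n (phi : formula L ('I_k + 'I_n)),
     ec_at g phi xi].

Definition atomic_codes : set (types L u) :=
  [set xi | forall k (g : 'I_k -> u), atomic_at g xi].

Lemma Gdelta_dense_ec_codes : Gdelta_dense (trace Xi ec_codes).
Proof.
apply: Gdelta_dense_forall => [|k]; first exact: countableP.
apply: Gdelta_dense_forall => [|g]; first exact: countable_ord_fun.
apply: Gdelta_dense_forall => [|n]; first exact: countableP.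
apply: Gdelta_dense_forall => [|phi]; last exact: Gdelta_dense_ec_at.
exact/formula_countable/countableP.
Qed.

Lemma Gdelta_dense_atomic_codes :
  (forall z : finType, dense (trace (F z) [set p | projectively_isolated F p])) ->
  Gdelta_dense (trace Xi atomic_codes).
Proof.
move=> iso; apply: Gdelta_dense_forall => [|k]; first exact: countableP.
apply: Gdelta_dense_forall => [|g]; first exact: countable_ord_fun.
exact: Gdelta_dense_atomic_at.
Qed.

Section CodedModel.
Variables (xi : types L u) (M : structure L).
Hypotheses (Xxi : Xi xi) (xiM : coded_by xi M).

Lemma coded_ec : ec_types F M <-> ec_codes xi.
Proof.
have [b tb sb] := (coded_by_surj _ _).1 xiM.
have /boolp.choice[v vK] := sb.
split=> [ecM k g n phi|ecxi x y phi a].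
  rewrite -tb => im; rewrite res_tp in im.
  have [c cphi] := ecM _ _ _ _ im.
  exists (v \o c); apply/sat_frename; move: cphi.
  by congr sat; apply/funext => -[i|j] //=; rewrite vK.
move=> [q [qphi Fq] qa].
pose r (w : x + y) : 'I_#|x| + 'I_#|y| :=
  match w with inl i => inl (enum_rank i) | inr j => inr (enum_rank j) end.
pose e (w : 'I_#|x| + 'I_#|y|) : x + y :=
  match w with inl i => inl (enum_val i) | inr j => inr (enum_val j) end.
have rK : e \o r = id by apply/funext => -[i|j] /=; rewrite enum_rankK.
have [|h] := ecxi _ (v \o a \o enum_val) _ (frename r phi).
  exists (res e q); first split.
  - by change (res r (res e q) phi); rewrite res_comp rK res_id.
  - exact: cltypes_pi.
  - rewrite -tb res_tp res_comp.
    rewrite -[LHS](res_comp inl enum_val q) qa res_tp; congr tp.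
    by apply/funext => i /=; rewrite vK.
rewrite -tb => /sat_frename/sat_frename hphi.
exists (b \o h \o enum_rank); move: hphi; congr sat.
by apply/funext => -[i|j] //=; rewrite vK enum_rankK.
Qed.

Lemma coded_atomic : ec_types F M -> projectively_atomic F M <-> atomic_codes xi.
Proof.
have [b tb sb] := (coded_by_surj _ _).1 xiM.
have /boolp.choice[v vK] := sb.
move=> ecM; split=> [atM k g|atxi x a].
  have [y [phi e]] := atM _ (b \o g).
  have [|c cphi] := ecM _ _ phi (b \o g); first by rewrite e.
  exists ('I_k + y)%type, phi, inl, (tcat g (v \o c)); split=> //.
    by exists (tp (b \o g)).
  rewrite -tb; apply/sat_frename; move: cphi; congr sat.
  by apply/funext => -[i|j] //=; rewrite vK.
have iso := atomic_at_isolated Xxi (atxi #|x| (v \o a \o enum_val)).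
have := isolated_res cL (@enum_rank x) iso; rewrite res_comp -tb res_tp.
by congr projectively_isolated; congr tp; apply/funext => i /=; rewrite enum_rankK vK.
Qed.

End CodedModel.

End Coding.

(** Every formula consistent with the class is realized in [M], by a tuple whose
    type is isolated. *)
Lemma isolated_types_dense (L : language) (F : hereditary_class L)
    (M : structure L) (x : finType) :
  amalgamation F -> model F M -> ec_types F M -> projectively_atomic F M ->
  dense (trace (F x) [set p | projectively_isolated F p]).
Proof.
move=> am mM ecM atM W [w Ww] /open_traceP[U /open_typesP oU WU].
have /oU[phi wphi sU] : U (set_val w) by move: Ww; rewrite WU.
have [|b bphi] := ec_realizes (phi := phi) am mM ecM.
  by exists (set_val w); split=> //; exact: set_type_elim.
have [a ab] := set_type_intro (mM x b); exists a.
rewrite WU /trace /preimage /=; split; rewrite /= ab; last exact: atM.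
exact: sU.
Qed.

Theorem theoremA9 (L : language) (u : choiceType) (F : hereditary_class L)
    (Xi : set (types L u)) :
  countable_language L ->
  countable [set: u] -> infinite_set [set: u] ->
  topological_fraisse F ->
  admissible_coding F Xi ->
  [/\ ((exists M : structure L, ec_proj_atomic_model F M) <->
       (forall x : finType,
          dense (trace (F x) [set p | projectively_isolated F p]))),
      ((forall M N : structure L,
          ec_proj_atomic_model F M -> ec_proj_atomic_model F N ->
          isomorphic M N) /\
       (forall M : structure L, ec_proj_atomic_model F M -> homogeneous M)) &
      forall M0 : structure L, model F M0 ->
        let C := trace Xi [set xi | coded_by xi M0] in
        (existentially_closed F M0 /\ projectively_atomic F M0 <->
         dense C /\ Gdelta C) /\
        (dense C /\ Gdelta C <-> ~ meager C)].
Proof.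
move=> cL cu _ frF coXi; have am := fraisse_amalgamation frF.
have bXi := coding_baire cL cu frF coXi.
have iXi := coding_inhabited coXi.
(* The generic codes are the codes of the models in question. *)
have goodP xi M : Xi xi -> coded_by xi M ->
    ec_proj_atomic_model F M <-> ec_codes F xi /\ atomic_codes F xi.
  move=> Xxi xiM; have mM := coded_by_model coXi Xxi xiM.
  split=> [[_ /(ec_typesP cL am mM) ecM atM]|[ecxi atxi]].
    by split; [exact/(coded_ec F xiM)|exact/(coded_atomic cL coXi Xxi xiM)].
  have ecM : ec_types F M by exact/(coded_ec F xiM).
  split=> //; first exact/(ec_typesP cL am mM).
  exact/(coded_atomic cL coXi Xxi xiM).
have uniq M N := ec_proj_atomic_unique cL am (M := M) (N := N).
have isoD M : ec_proj_atomic_model F M ->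
    forall x : finType, dense (trace (F x) [set p | projectively_isolated F p]).
  by move=> [mM /(ec_typesP cL am mM) ecM atM] x; exact: isolated_types_dense ecM atM.
split.
- split=> [[M gM]|iso]; first exact: isoD gM.
  have [w [_ [ecw atw]]] := bXi _ (Gdelta_denseI
    (Gdelta_dense_ec_codes cL cu frF coXi)
    (Gdelta_dense_atomic_codes cu coXi iso)) setT iXi openT.
  have Xw := set_type_elim w; have [M wM] := coding_exists cu coXi Xw.
  by exists M; apply/(goodP _ _ Xw wM).
- by split=> // M; exact: ec_proj_atomic_homogeneous.
move=> M0 mM0 C.
have ab : existentially_closed F M0 /\ projectively_atomic F M0 -> dense C /\ Gdelta C.
  move=> [ec0 at0]; have g0 : ec_proj_atomic_model F M0 by [].
  suff gC : Gdelta_dense C by split; [exact: bXi|exact: Gdelta_denseW].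
  (* A generic code is a code of [M0], by uniqueness. *)
  have -> : C = trace Xi (ec_codes F) `&` trace Xi (atomic_codes F).
    apply/seteqP; split=> a; have Xa := set_type_elim a.
      by move=> aM0; exact: ((goodP _ _ Xa aM0).1 g0).
    move=> gooda; have [M aM] := coding_exists cu coXi Xa.
    have [h [eh [h' hK h'K]]] := uniq _ _ ((goodP _ _ Xa aM).2 gooda) g0.
    have [b tb sb] := (coded_by_surj _ _).1 aM.
    apply/coded_by_surj; exists (h \o b); first by rewrite -tb; exact: embedding_tp.
    by move=> m; have [v bv] := sb (h' m); exists v; rewrite /= bv.
  apply: Gdelta_denseI; first exact: Gdelta_dense_ec_codes.
  exact: Gdelta_dense_atomic_codes (isoD _ g0).
have bc : dense C /\ Gdelta C -> ~ meager C.
  move=> [dC gC]; apply: Gdelta_dense_nonmeager => //.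
  exact: dense_Gdelta_dense.
have ca : ~ meager C -> existentially_closed F M0 /\ projectively_atomic F M0.
  move=> nC.
  have [w [wM ecw]] := nonmeager_meets nC (Gdelta_dense_ec_codes cL cu frF coXi).
  split; first exact/(ec_typesP cL am mM0)/(coded_ec F wM).
  move=> x a; apply: contrapT => niso.
  have [b tb sb] := (coded_by_surj _ _).1 wM.
  (* Some code of [M0] omits the type of [a], which [M0] realizes. *)
  have gO : Gdelta_dense (trace Xi
      [set xi | forall g : x -> u, res g xi <> tp a]).
    apply: Gdelta_dense_forall => [|g]; last exact: (Gdelta_dense_omit cL coXi g niso).
    pose r (g : x -> u) : 'I_#|x| -> u := g \o enum_val.
    apply: (countable_inj (f := r)).
      move=> g g' e; apply/funext => i.
      by have := congr1 (@^~ (enum_rank i)) e; rewrite /r /= enum_rankK.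
    exact: countable_ord_fun.
  have [v [/coded_by_surj[c tc sc] vO]] := nonmeager_meets nC gO.
  have /boolp.choice[s sK] := sc.
  apply: (vO (s \o a)); rewrite -tc res_tp; congr tp.
  by apply/funext => i /=; rewrite sK.
by split; split=> // h; [apply: ca; apply: bc|apply: ab; apply: ca].
Qed.
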